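(* The theory $T_{Cantor-A}$ has no model companion. In particular, $T_{Cantor-A}$ is not model complete and does not have quantifier elimination.
   Context: We work in continuous first-order logic for C*-algebras (in the sense of Farah–Hart–Sherman). Let $\mathcal{L}_{C^*}$ be the language of unital C*-algebras and let $\mathcal{L}$ be $\mathcal{L}_{C^*}$ together with a new unary function symbol $\sigma$. A compact Hausdorff space $X$ with a homeomorphism $S:X\to X$ corresponds to the $\mathcal{L}$-structure $(C(X),\sigma)$, where $\sigma(f)=f\circ S$. Let $T_{C^*-A}$ be the $\mathcal{L}$-theory whose models are exactly the structures $(M,\sigma)$ with $M$ a commutative unital C*-algebra and $\sigma$ an automorphism of $M$. Let $T_{Cantor}$ be an $\mathcal{L}_{C^*}$-theory whose models are exactly the algebras $C(X)$ with $X$ a compact $0$-dimensional Hausdorff space without isolated points. Set $T_{Cantor-A}=T_{Cantor}\cup T_{C^*-A}$. *)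

(* Defs.v *)
From HB Require Import structures.
From mathcomp Require Import all_boot all_order all_algebra.
From mathcomp Require Import all_classical all_reals all_analysis.
From mathcomp Require Import complex.

Set Implicit Arguments.
Unset Strict Implicit.
Unset Printing Implicit Defensive.

Import Order.TTheory GRing.Theory Num.Theory.
Import numFieldNormedType.Exports.
Import ComplexField.Normc.

Local Open Scope classical_set_scope.
Local Open Scope ring_scope.

(**md**************************************************************************)
(* # Continuous logic for C*-algebras with an automorphism                    *)
(*                                                                            *)
(* Continuous first-order logic in the sense of Farah, Hart and Sherman, for  *)
(* single-sorted languages whose only relation symbol is the metric.  The     *)
(* sort is exhausted by domains of quantification D_k, k : nat; quantifiers   *)
(* range over these domains.  As usual in that framework, the language itself *)
(* prescribes, for every function symbol f and all domains D_(k i) of its     *)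
(* arguments, a domain containing the values of f and a modulus of uniform    *)
(* continuity of f, and it prescribes a bound of the metric on D_j x D_k.     *)
(******************************************************************************)

Section Syntax.
Context {R : realType}.

Record language := Language {
  fsym : Type;
  arity : fsym -> nat;
  fdom : forall f : fsym, ('I_(arity f) -> nat) -> nat;
  fmod : forall f : fsym, ('I_(arity f) -> nat) -> R -> R;
  fmod_gt0 : forall (f : fsym) (k : 'I_(arity f) -> nat) (e : R),
    0 < e -> 0 < fmod k e;
  mbound : nat -> nat -> R }.

Inductive term (L : language) (n : nat) : Type :=
| Var of 'I_n
| App (f : fsym L) of ('I_(arity f) -> term L n).

(* [formula L n] : formulas with free variables among x_0, .., x_(n-1); the   *)
(* quantifiers bind x_0 and shift the other variables                         *)
Inductive formula (L : language) : nat -> Type :=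
| FDist n of term L n & term L n : formula L n
| FConn n m (u : 'rV[R]_m -> R) of continuous u & ('I_m -> formula L n) :
    formula L n
| FSup n (k : nat) of formula L n.+1 : formula L n
| FInf n (k : nat) of formula L n.+1 : formula L n.

Fixpoint quantifier_free (L : language) n (phi : formula L n) : Prop :=
  match phi with
  | FDist _ _ _ => True
  | FConn _ _ _ _ phis => forall i, quantifier_free (phis i)
  | FSup _ _ _ | FInf _ _ _ => False
  end.

Definition sentence (L : language) := formula L 0.

Definition theory (L : language) := set (sentence L).

End Syntax.
Arguments language R : clear implicits.
Arguments FDist {R L n}.
Arguments FConn {R L n m u}.
Arguments FSup {R L n}.
Arguments FInf {R L n}.

Definition novar (T : Type) : 'I_0 -> T :=
  fun i => False_rect T (notF (ltn_ord i)).

Definition vcons (T : Type) n (x : T) (v : 'I_n -> T) : 'I_n.+1 -> T :=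
  fun i => if unlift ord0 i is Some j then v j else x.

Section Semantics.
Context {R : realType}.
Implicit Types L : language R.

Record structure L := Structure {
  carrier :> metricType R;
  dom : nat -> set carrier;
  dom_neq0 : forall k, dom k !=set0;
  dom_cover : forall x, exists k, dom k x;
  dom_complete : forall k (u : nat -> carrier),
    (forall n, dom k (u n)) -> cauchy (u @ \oo) ->
    exists2 x, dom k x & u @ \oo --> x;
  dom_bounded : forall j k x y,
    dom j x -> dom k y -> mdist x y <= mbound L j k;
  fint : forall f : fsym L, ('I_(arity f) -> carrier) -> carrier;
  fint_dom : forall (f : fsym L) (k : 'I_(arity f) -> nat) a,
    (forall i, dom (k i) (a i)) -> dom (fdom k) (fint a);
  fint_unif : forall (f : fsym L) (k : 'I_(arity f) -> nat) (e : R) a b,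
    0 < e -> (forall i, dom (k i) (a i)) -> (forall i, dom (k i) (b i)) ->
    (forall i, mdist (a i) (b i) < fmod k e) ->
    mdist (fint a) (fint b) <= e }.

Fixpoint teval L (M : structure L) n (v : 'I_n -> M) (t : term L n) : M :=
  match t with
  | Var i => v i
  | App f args => fint (fun i => teval v (args i))
  end.

Fixpoint feval L (M : structure L) n (phi : formula L n) :
    ('I_n -> M) -> R :=
  match phi with
  | FDist _ s t => fun v => mdist (teval v s) (teval v t)
  | FConn _ _ u _ phis => fun v => u (\row_i feval (phis i) v)
  | FSup _ k psi => fun v => sup [set feval psi (vcons x v) | x in dom k]
  | FInf _ k psi => fun v => inf [set feval psi (vcons x v) | x in dom k]
  end.

Definition models L (T : theory L) (M : structure L) : Prop :=
  forall phi, T phi -> feval phi (@novar M) = 0.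

(* Domains are part of the structure: the domains of a substructure are the   *)
(* traces of the domains of the ambient structure.                            *)
Record embedding L (M N : structure L) (h : M -> N) : Prop := Embedding {
  emb_dist : forall x y, mdist (h x) (h y) = mdist x y;
  emb_dom : forall k x, dom k (h x) <-> dom k x;
  emb_fint : forall (f : fsym L) (a : 'I_(arity f) -> M),
    h (fint a) = fint (h \o a) }.

Definition elementary L (M N : structure L) (h : M -> N) : Prop :=
  forall n (phi : formula L n) (v : 'I_n -> M),
    feval phi (h \o v) = feval phi v.

Definition model_complete L (T : theory L) : Prop :=
  forall (M N : structure L) (h : M -> N),
    models T M -> models T N -> embedding h -> elementary h.

Definition embeds_in_models L (T T' : theory L) : Prop :=
  forall M : structure L, models T M ->
    exists (N : structure L) (h : M -> N), models T' N /\ embedding h.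

Definition model_companion L (T T' : theory L) : Prop :=
  [/\ model_complete T', embeds_in_models T T' & embeds_in_models T' T].

(* In continuous logic, equivalence to a quantifier-free formula means        *)
(* uniform approximability by quantifier-free formulas, on each product of    *)
(* domains and in all models of the theory.                                   *)
Definition quantifier_elimination L (T : theory L) : Prop :=
  forall n (phi : formula L n) (k : 'I_n -> nat) (e : R), 0 < e ->
    exists2 psi : formula L n, quantifier_free psi &
      forall (M : structure L) (v : 'I_n -> M), models T M ->
        (forall i, dom (k i) (v i)) -> `|feval phi v - feval psi v| <= e.

End Semantics.

(* Expansion of a language by a new unary function symbol [None], prescribed  *)
(* to map each D_k to itself and to be 1-Lipschitz.                           *)
Section Expansion.
Context {R : realType} (L : language R).

Definition add_arity (f : option (fsym L)) : nat :=
  if f is Some g then arity g else 1.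

Definition add_fdom (f : option (fsym L)) : ('I_(add_arity f) -> nat) -> nat :=
  match f with Some g => @fdom R L g | None => fun k => k ord0 end.

Definition add_fmod (f : option (fsym L)) :
    ('I_(add_arity f) -> nat) -> R -> R :=
  match f with Some g => @fmod R L g | None => fun _ e => e end.

Lemma add_fmod_gt0 (f : option (fsym L)) (k : 'I_(add_arity f) -> nat) (e : R) :
  0 < e -> 0 < add_fmod k e.
Proof. by case: f k => [g|//] k e0; exact: fmod_gt0. Qed.

Definition add_unary : language R :=
  @Language R _ add_arity add_fdom add_fmod add_fmod_gt0 (mbound L).

Fixpoint lift_term n (t : term L n) : term add_unary n :=
  match t with
  | Var i => Var add_unary i
  | App f args =>
      @App R add_unary n (Some f) (fun i => lift_term (args i))
  end.

Fixpoint lift_formula n (phi : formula L n) : formula add_unary n :=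
  match phi with
  | FDist _ s t => FDist (lift_term s) (lift_term t)
  | FConn _ _ _ cu phis => FConn cu (fun i => lift_formula (phis i))
  | FSup _ k psi => FSup k (lift_formula psi)
  | FInf _ k psi => FInf k (lift_formula psi)
  end.

Definition reduct (M : structure add_unary) : structure L :=
  @Structure R L M (@dom _ _ M) (@dom_neq0 _ _ M) (@dom_cover _ _ M)
    (@dom_complete _ _ M) (@dom_bounded _ _ M)
    (fun f => @fint _ _ M (Some f))
    (fun f => @fint_dom _ _ M (Some f))
    (fun f => @fint_unif _ _ M (Some f)).

Definition new_fun (M : structure add_unary) (x : M) : M :=
  @fint _ _ M None (vcons x (@novar M)).

End Expansion.

Notation Cplx R := (R[i] : numFieldType) (only parsing).

(* The language of unital C*-algebras: D_k is meant to be the closed ball of  *)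
(* radius k, and the distance is |x - y|.                                     *)
Section CstarLanguage.
Context (R : realType).

Inductive csym : Type :=
| Czero | Cone | Cadd | Cmul | Cstar | Cscale of R[i].

Definition carity (f : csym) : nat :=
  match f with
  | Czero | Cone => 0
  | Cadd | Cmul => 2
  | Cstar | Cscale _ => 1
  end.

Definition cdom (f : csym) : ('I_(carity f) -> nat) -> nat :=
  match f with
  | Czero => fun=> 0%N
  | Cone => fun=> 1%N
  | Cadd => fun k => (k ord0 + k ord_max)%N
  | Cmul => fun k => (k ord0 * k ord_max)%N
  | Cstar => fun k => k ord0
  | Cscale z => fun k => (`|Num.ceil (normc z)|%N * k ord0)%N
  end.

Definition cmod (f : csym) : ('I_(carity f) -> nat) -> R -> R :=
  match f with
  | Czero | Cone | Cstar => fun _ e => e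
  | Cadd => fun _ e => e / 2
  | Cmul => fun k e => e / (k ord0 + k ord_max).+1%:R
  | Cscale z => fun _ e => e / (normc z + 1)
  end.

Lemma cmod_gt0 (f : csym) (k : 'I_(carity f) -> nat) (e : R) :
  0 < e -> 0 < cmod k e.
Proof.
case: f k => [||||| z] k e0 //=; rewrite divr_gt0 ?ltr0n//.
by rewrite ltr_wpDl//; case: (z) => a b; exact: sqrtr_ge0.
Qed.

Definition L_cstar : language R :=
  @Language R csym carity cdom cmod cmod_gt0 (fun j k => (j + k)%:R).

Definition L_cstar_sigma : language R := add_unary L_cstar.

Definition czero (M : structure L_cstar) : M :=
  @fint _ _ M Czero (@novar M).
Definition cone (M : structure L_cstar) : M :=
  @fint _ _ M Cone (@novar M).
Definition cadd (M : structure L_cstar) (x y : M) : M :=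
  @fint _ _ M Cadd (vcons x (vcons y (@novar M))).
Definition cmul (M : structure L_cstar) (x y : M) : M :=
  @fint _ _ M Cmul (vcons x (vcons y (@novar M))).
Definition cstar (M : structure L_cstar) (x : M) : M :=
  @fint _ _ M Cstar (vcons x (@novar M)).
Definition cscale (M : structure L_cstar) (z : R[i]) (x : M) : M :=
  @fint _ _ M (Cscale z) (vcons x (@novar M)).
Definition cnorm (M : structure L_cstar) (x : M) : R := mdist x (czero M).

End CstarLanguage.
Arguments cscale {R M}.

Section CstarStructures.
Context {R : realType}.

(* M is a commutative unital C*-algebra with D_k its closed k-ball.  Norm     *)
(* completeness is already contained in [dom_complete], and -x is (-1) x.     *)
Record comm_cstar_algebra (M : structure (L_cstar R)) : Prop := CommCstar {
  caddA : associative (@cadd R M);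
  caddC : commutative (@cadd R M);
  cadd0 : right_id (czero M) (@cadd R M);
  caddN : forall x : M, cadd x (cscale (-1) x) = czero M;
  cscaleA : forall (a b : R[i]) (x : M),
    cscale a (cscale b x) = cscale (a * b) x;
  cscale1 : forall x : M, cscale 1 x = x;
  cscaleDr : forall (a : R[i]) (x y : M),
    cscale a (cadd x y) = cadd (cscale a x) (cscale a y);
  cscaleDl : forall (a b : R[i]) (x : M),
    cscale (a + b) x = cadd (cscale a x) (cscale b x);
  cmulA : associative (@cmul R M);
  cmulC : commutative (@cmul R M);
  cmul1 : right_id (cone M) (@cmul R M);
  cmulDl : left_distributive (@cmul R M) (@cadd R M);
  cscaleAl : forall (a : R[i]) (x y : M),
    cscale a (cmul x y) = cmul (cscale a x) y;
  cstarK : involutive (@cstar R M);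
  cstarD : forall x y : M, cstar (cadd x y) = cadd (cstar x) (cstar y);
  cstarZ : forall (a : R[i]) (x : M),
    cstar (cscale a x) = cscale a^* (cstar x);
  cstarM : forall x y : M, cstar (cmul x y) = cmul (cstar y) (cstar x);
  cdistE : forall x y : M, mdist x y = cnorm (cadd x (cscale (-1) y));
  cnormZ : forall (a : R[i]) (x : M), cnorm (cscale a x) = normc a * cnorm x;
  cnormM : forall x y : M, cnorm (cmul x y) <= cnorm x * cnorm y;
  cnorm_star : forall x : M, cnorm (cmul (cstar x) x) = cnorm x ^+ 2;
  cdomE : forall k (x : M), dom k x <-> cnorm x <= k%:R }.

Record star_automorphism (M : structure (L_cstar R)) (s : M -> M) : Prop :=
  StarAutomorphism {
  aut_bij : bijective s;
  autD : forall x y : M, s (cadd x y) = cadd (s x) (s y);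
  autZ : forall (a : R[i]) (x : M), s (cscale a x) = cscale a (s x);
  autM : forall x y : M, s (cmul x y) = cmul (s x) (s y);
  aut1 : s (cone M) = cone M;
  autS : forall x : M, s (cstar x) = cstar (s x) }.

(* Phi is an isomorphism of M with the structure C(X): continuous functions   *)
(* X -> C, pointwise operations, supremum distance, D_k the k-ball.           *)
Record iso_CX (M : structure (L_cstar R)) (X : topologicalType)
    (Phi : M -> X -> Cplx R) : Prop := IsoCX {
  CX_continuous : forall a, continuous (Phi a);
  CX_surj : forall f : X -> Cplx R, continuous f -> exists a, Phi a = f;
  CX_dist : forall a b,
    mdist a b = sup [set normc (Phi a x - Phi b x) | x in [set: X]];
  CX_dom : forall k a, dom k a <-> forall x, normc (Phi a x) <= k%:R;
  CX_zero : forall x, Phi (czero M) x = 0;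
  CX_one : forall x, Phi (cone M) x = 1;
  CX_add : forall a b x, Phi (cadd a b) x = Phi a x + Phi b x;
  CX_mul : forall a b x, Phi (cmul a b) x = Phi a x * Phi b x;
  CX_star : forall a x, Phi (cstar a) x = (Phi a x : R[i])^*;
  CX_scale : forall (z : R[i]) a x, Phi (cscale z a) x = z * Phi a x }.

Definition axiomatizes_cstar_A (T : theory (L_cstar_sigma R)) : Prop :=
  forall M : structure (L_cstar_sigma R),
    models T M <->
    comm_cstar_algebra (reduct M) /\
    @star_automorphism (reduct M) (@new_fun R (L_cstar R) M).

(* [cantor_like X] : X is compact, Hausdorff, zero-dimensional and perfect    *)
(* (metrizability is not required).                                           *)
Definition axiomatizes_cantor (T : theory (L_cstar R)) : Prop :=
  forall M : structure (L_cstar R),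
    models T M <->
    exists2 X : topologicalType, cantor_like X &
      exists Phi : M -> X -> Cplx R, iso_CX Phi.

Definition T_cantor_A (Tcantor : theory (L_cstar R))
    (TcstarA : theory (L_cstar_sigma R)) : theory (L_cstar_sigma R) :=
  (@lift_formula R (L_cstar R) 0 @` Tcantor) `|` TcstarA.

End CstarStructures.

(* Main.v *)
From HB Require Import structures.
From mathcomp Require Import all_boot all_order all_algebra.
From mathcomp Require Import all_classical all_reals all_analysis.
From mathcomp Require Import complex ring lra zify.
Require Import Defs.

(* A model (M, s) of the theory is C(X) with s f = f \o S.  Call f in M
   tripotent when f^3 = f, that is, when f takes values in {-1, 0, 1}, and
   measure by inf_c d(c^2, 1) + d(s c, c) + d(c f, f^2) how far f is from being
   separated by an s-invariant sign c, with c = 1 on {f = 1} and c = -1 on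
   {f = -1}.  If f takes both values 1 and -1 on some orbit of S, which means
   that some f * s^n f fails to be idempotent, this infimum is at least 1/2.
   Otherwise it vanishes in an extension of (M, s): replace X by the pairs
   (x, e) such that f takes only the values 0 and e on the orbit of x, times
   the Cantor space.

   Some model contains, for every k, a tripotent f_k which takes the values 1
   and -1 on one orbit, but only at points more than k steps apart.  Given a
   model companion T', the f_k live in a model of T', and their class f in an
   ultrapower of it has all f * s^n f idempotent, while the infimum for f is at
   least 1/2 by Los's theorem.  The ultrapower embeds in a model of T, this one
   in a model of T where f is separated by an invariant sign, and that one in
   a model of T', which contradicts the model completeness of T'. *)

Set Implicit Arguments.
Unset Strict Implicit.
Unset Printing Implicit Defensive.

Import Order.TTheory GRing.Theory Num.Theory.
Import numFieldNormedType.Exports.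
Import ComplexField.Normc.

Local Open Scope classical_set_scope.
Local Open Scope ring_scope.

(** * Continuous logic *)

(** For tripotent f, having opposite signs on an orbit is an infinite disjunction over n, while the
    infimum is the value of one formula. In models of a companion, opposite signs would mean infimum
    at least 1/2 and their absence infimum 0; compactness would then bound n, and the [f_k] show
    that no bound exists.

    Since T' is arbitrary, nothing is known about the shape of its models, which are reached only
    through embeddings. Hence tripotency and idempotency are stated as equations, which embeddings
    preserve and reflect, and the estimate from below is made for each c separately: the defect of a
    pair does not change in a larger structure, so it can be bounded in a model of T, where
    functions on a space are available. The infimum itself is transported only by [los] and by model
    completeness.

    Models of [Tcantor] come with their space X. What has to be built from Gelfand duality is the
    homeomorphism of X dual to the automorphism. *)

Lemma vcons0 (T : Type) n (x : T) (v : 'I_n -> T) : vcons x v ord0 = x.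
Proof. by rewrite /vcons unlift_none. Qed.

Lemma vconsS (T : Type) n (x : T) (v : 'I_n -> T) (i : 'I_n) :
  vcons x v (lift ord0 i) = v i.
Proof. by rewrite /vcons liftK. Qed.

Lemma vcons_max (T : Type) (x : T) (v : 'I_1 -> T) : vcons x v ord_max = v ord0.
Proof.
by rewrite (_ : ord_max = lift ord0 ord0 :> 'I_2) ?vconsS//; exact: val_inj.
Qed.

Lemma vcons_ind (S T : Type) (P : S -> T -> Prop) n (x : S) (v : 'I_n -> S)
    (y : T) (w : 'I_n -> T) :
  P x y -> (forall i, P (v i) (w i)) ->
  forall i, P (vcons x v i) (vcons y w i).
Proof.
by move=> Px Pv i; case: (unliftP ord0 i) => [j|] ->; rewrite ?vconsS ?vcons0.
Qed.

Lemma map_vcons (S T : Type) (h : S -> T) n (x : S) (v : 'I_n -> S) :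
  h \o vcons x v = vcons (h x) (h \o v).
Proof.
by apply/funext => i/=; case: (unliftP ord0 i) => [j|] ->; rewrite ?vconsS ?vcons0.
Qed.

Lemma map_novar (S T : Type) (h : S -> T) : h \o @novar S = @novar T.
Proof. by apply/funext => -[]. Qed.

Lemma eq_novar (T : Type) (v : 'I_0 -> T) : v = @novar T.
Proof. by apply/funext => -[]. Qed.

Section ContinuousLogic.
Context {R : realType} {L : language R}.
Implicit Types M N P : structure L.

Lemma teval_dom M n (t : term L n) (k : 'I_n -> nat) :
  exists K, forall v : 'I_n -> M, (forall i, dom (k i) (v i)) ->
    dom K (teval v t).
Proof.
elim: t => [i|f args IH]; first by exists (k i).
exists (fdom (fun i => projT1 (cid (IH i)))) => v kv.
apply: fint_dom => i; exact: (projT2 (cid (IH i))) v kv.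
Qed.

(** A connective is merely continuous on all of R^m, hence possibly unbounded; bounded arguments
    keep it on a compact cube. *)
Lemma bounded_continuous_rV m (u : 'rV[R]_m -> R) (B : 'I_m -> R) :
  continuous u ->
  exists C, forall x : 'rV[R]_m, (forall i, `|x ord0 i| <= B i) -> `|u x| <= C.
Proof.
move=> cu; pose D := \sum_i `|B i|.
pose A := [set x : 'rV[R]_m | forall i, `|x ord0 i| <= D].
have cA : compact A.
  pose S (i : 'I_m) := [set` `[- D, D]].
  have -> : A = [set v : 'rV[R]_m | forall i, S i (v ord0 i)].
    by apply/seteqP; split => x Ax i; have := Ax i; rewrite /S /= in_itv/= ler_norml.
  by apply: rV_compact => i; exact: segment_compact.
have D0 : 0 <= D by apply: sumr_ge0.
have A0 : A !=set0 by exists 0 => i; rewrite mxE normr0.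
have cnu : {within A, continuous (fun x => `|u x|)}.
  apply: continuous_subspaceT => x.
  by apply: continuous_comp; [exact: cu|exact: (@norm_continuous R R^o)].
have [c _ cmax] := EVT_max_rV A0 cA cnu.
exists `|u c| => x xB; apply: cmax; rewrite inE => i.
rewrite (le_trans (xB i))// (le_trans (ler_norm _))//.
by rewrite /D (bigD1 i)//= lerDl sumr_ge0.
Qed.

(** [sup] and [inf] take a default value on unbounded sets; these bounds make every quantifier a
    genuine supremum or infimum. *)
Lemma feval_bounded M n (phi : formula L n) (k : 'I_n -> nat) :
  exists B, forall v : 'I_n -> M, (forall i, dom (k i) (v i)) ->
    `|feval phi v| <= B.
Proof.
elim: phi k => {n} [n s t|n m u cu phis IH|n l psi IH|n l psi IH] k /=.
- have [K sK] := teval_dom M s k; have [J tJ] := teval_dom M t k.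
  exists (mbound L K J) => v kv; rewrite ger0_norm ?mdist_ge0//.
  by apply: dom_bounded; [exact: sK|exact: tJ].
- pose B i := projT1 (cid (IH i k)).
  have [C uC] := bounded_continuous_rV B cu.
  by exists C => v kv; apply: uC => i; rewrite mxE; exact: (projT2 (cid (IH i k))).
- have [B psiB] := IH (vcons l k); exists B => v kv.
  have {}psiB x : dom l x -> `|feval psi (vcons x v)| <= B.
    by move=> lx; apply: psiB; exact: vcons_ind.
  have [x0 lx0] := dom_neq0 M l.
  have supE : has_sup [set feval psi (vcons x v) | x in dom l].
    split; first by exists (feval psi (vcons x0 v)), x0.
    by exists B => _ [x lx <-]; rewrite (le_trans (ler_norm _))// psiB.
  rewrite ler_norml; apply/andP; split.
    apply: (@le_trans _ _ (feval psi (vcons x0 v))); last first.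
      by apply: sup_upper_bound => //; exists x0.
    by have := psiB _ lx0; rewrite ler_norml => /andP[].
  apply: ge_sup => [|_ [x lx <-]]; first by case: supE.
  by rewrite (le_trans (ler_norm _))// psiB.
- have [B psiB] := IH (vcons l k); exists B => v kv.
  have {}psiB x : dom l x -> `|feval psi (vcons x v)| <= B.
    by move=> lx; apply: psiB; exact: vcons_ind.
  have [x0 lx0] := dom_neq0 M l.
  have infE : has_inf [set feval psi (vcons x v) | x in dom l].
    split; first by exists (feval psi (vcons x0 v)), x0.
    by exists (- B) => _ [x lx <-]; have := psiB _ lx; rewrite ler_norml => /andP[].
  rewrite ler_norml; apply/andP; split.
    apply: lb_le_inf => [|_ [x lx <-]]; first by case: infE.
    by have := psiB _ lx; rewrite ler_norml => /andP[].
  apply: (@le_trans _ _ (feval psi (vcons x0 v))).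
    by apply: ge_inf; [case: infE|exists x0].
  by rewrite (le_trans (ler_norm _))// psiB.
Qed.

Lemma embedding_id M : @embedding R L M M id.
Proof. by split. Qed.

Lemma embedding_comp M N P (h : M -> N) (g : N -> P) :
  embedding h -> embedding g -> embedding (g \o h).
Proof.
move=> [hd hk hf] [gd gk gf]; split => [x y|k x|f a] /=.
- by rewrite gd hd.
- by rewrite gk hk.
- by rewrite hf gf.
Qed.

Lemma embedding_teval M N (h : M -> N) n (v : 'I_n -> M) (t : term L n) :
  embedding h -> teval (h \o v) t = h (teval v t).
Proof.
move=> eh; elim: t => [//|f args IH] /=.
by rewrite (emb_fint eh); congr fint; apply/funext => i /=; exact: IH.
Qed.

Lemma embedding_qf M N (h : M -> N) n (phi : formula L n) (v : 'I_n -> M) :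
  embedding h -> quantifier_free phi -> feval phi (h \o v) = feval phi v.
Proof.
move=> eh; elim: phi v => {n} [n s t|n m u cu phis IH|n k psi _|n k psi _] v
  /= => [_|qf|[]|[]].
  by rewrite !embedding_teval// (emb_dist eh).
by congr (u _); apply/rowP => i; rewrite !mxE; exact: IH.
Qed.

(** A theory without a model companion is therefore not model complete, which is how the second
    claim follows from the first. *)
Lemma model_companion_refl (T : theory L) : model_complete T -> model_companion T T.
Proof. by split => // M MT; exists M, id; split => //; exact: embedding_id. Qed.

(** One quantifier-free formula approximates [phi] within e/2 both in [M] and in [N]; the embedding
    preserves its value as well as the domains of the parameters, and e is arbitrary. *)
Lemma quantifier_elimination_model_complete (T : theory L) :
  quantifier_elimination T -> model_complete T.
Proof.
move=> qeT M N h MT NT eh n phi v; apply/eqP; rewrite -subr_eq0 -normr_eq0.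
rewrite eq_le normr_ge0 andbT; apply/ler_addgt0Pl => e e0; rewrite addr0.
pose k i := projT1 (cid (dom_cover (v i))).
have kv i : dom (k i) (v i) by exact: (projT2 (cid (dom_cover (v i)))).
have e20 : 0 < e / 2 by rewrite divr_gt0.
have [psi qf psiE] := qeT n phi k _ e20.
have := psiE N (h \o v) NT (fun i => (emb_dom eh _ _).2 (kv i)).
rewrite (embedding_qf _ eh qf) => H1; have := psiE M v MT kv; rewrite distrC => H2.
rewrite [leRHS]splitr (le_trans _ (lerD H1 H2))//.
by rewrite (le_trans _ (ler_normD _ _))// addrA subrK.
Qed.

End ContinuousLogic.

(** * Lifted formulas and reducts *)

Section Expansion.
Context {R : realType} {L : language R} (M : structure (add_unary L)).

Lemma teval_lift n (v : 'I_n -> M) (t : term L n) :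
  teval v (lift_term t) = teval (M := reduct M) v t.
Proof.
by elim: t => [//|f args IH] /=; congr fint; apply/funext => i; exact: IH.
Qed.

Lemma feval_lift n (v : 'I_n -> M) (phi : formula L n) :
  feval (lift_formula phi) v = feval (M := reduct M) phi v.
Proof.
elim: phi v => {n} [n s t|n m u cu phis IH|n l psi IH|n l psi IH] v /=.
- by rewrite !teval_lift.
- by congr (u _); apply/rowP => i; rewrite !mxE.
- by congr sup; apply: eq_imagel => x _; exact: IH.
- by congr inf; apply: eq_imagel => x _; exact: IH.
Qed.

Lemma models_lift (T : theory L) :
  models (@lift_formula R L 0 @` T) M <-> models T (reduct M).
Proof.
split => [MT phi Tphi|MT _ [phi Tphi <-]].
  by rewrite -(feval_lift (@novar M) phi); apply: MT; exists phi.
by rewrite feval_lift; exact: MT.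
Qed.

End Expansion.

(** * Ultrapowers *)

Section MetricOfDist.
Context {R : realType} (T : Type) (d : T -> T -> R).
Hypothesis dxx : forall x, d x x = 0.
Hypothesis d_eq0 : forall x y, d x y = 0 -> x = y.
Hypothesis dC : forall x y, d x y = d y x.
Hypothesis d_triangle : forall y x z, d x z <= d x y + d y z.

(** A metric type must carry a choice structure; on an arbitrary type it is obtained classically. *)
Definition dist_choice : choiceType :=
  HB.pack_for choiceType T (gen_eqMixin T) (gen_choiceMixin T).

Definition dist_metric : metricType R :=
  HB.pack_for (metricType R) dist_choice
    (isMetric.Build R dist_choice dxx d_eq0 dC d_triangle).

Lemma dist_metricE (x y : T) : mdist (x : dist_metric) y = d x y.
Proof. by []. Qed.

End MetricOfDist.

Section MetricSequences.
Context {R : realType} {T : metricType R}.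

Lemma cauchy_seq_mdist (u : nat -> T) : cauchy (u @ \oo) ->
  forall e : R, 0 < e -> exists N, forall m n, (N <= m)%N -> (N <= n)%N ->
    mdist (u m) (u n) < e.
Proof.
move=> /cauchy_ballP cu e e0.
have [[P Q] [/= [N1 _ PN] [N2 _ QN]] PQ] := cu _ e0.
exists (maxn N1 N2) => m n; rewrite !geq_max => /andP[m1 m2] /andP[n1 n2].
have := PQ (u m, u n); rewrite /= ballEmdist; apply; split; [exact: PN|exact: QN].
Qed.

Lemma cvg_seq_mdist (u : nat -> T) (l : T) :
  (forall e : R, 0 < e -> exists N, forall n, (N <= n)%N -> mdist l (u n) < e) ->
  u @ \oo --> l.
Proof.
move=> ul; apply/metricType_numDomainType.cvgrPdist_lt => e e0.
by have [N uN] := ul e e0; exists N.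
Qed.

End MetricSequences.

(** * Limits along an ultrafilter *)

Section UltrafilterLimits.
Context {R : realType} {T : Type} {U : set_system T} {UU : UltraFilter U}.

(** Compactness of the segment gives a cluster point, and an ultrafilter converges to each of its
    cluster points. *)
Lemma ultrafilter_bounded_cvg (x : T -> R) (B : R) :
  (forall i, `|x i| <= B) -> cvg (x i @[i --> U]).
Proof.
move=> xB; have /= := @segment_compact R (- B) B.
move=> /(_ (x @ U) _) /(_ _) [|p [_ clp]].
  by apply: (@filterE _ U) => i /=; have := xB i; rewrite in_itv/= ler_norml.
apply/cvg_ex; exists p => V Vp; rewrite /= nbhs_filterE.
case: (in_ultra_setVsetC (x @^-1` V) UU) => // UV.
by have [y []] := clp (~` V) V UV Vp.
Qed.

Lemma cvg_rowP n (x : T -> 'I_n -> R) (y : 'rV[R]_n) :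
  (forall j, x i j @[i --> U] --> y ord0 j) ->
  (\row_j x i j) @[i --> U] --> y.
Proof.
move=> xy V [P /= yP PV]; rewrite nbhs_filterE /=.
have : \forall i \near U, forall j, P ord0 j (x i j).
  apply: filter_forall => j; exact: xy j _ (yP ord0 j).
by apply: filterS => i Pi; apply: PV => j k; rewrite mxE (ord1 j); exact: Pi.
Qed.

End UltrafilterLimits.

(** * The ultrapower and Los's theorem *)

Section Ultrapower.
Context {R : realType} {L : language R} (M : structure L) (U : set_system nat).

(** A [structure] is not asked to have increasing domains. The ultrapower uses this to place two
    representatives of an element in one domain, where the moduli of continuity apply. *)
Definition dom_nested := forall k l, (k <= l)%N -> @dom _ _ M k `<=` dom l.

Definition ubounded (u : nat -> M) := exists k, forall i, dom k (u i).

Definition udist (u v : nat -> M) : R := lim (mdist (u i) (v i) @[i --> U]).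

Definition ueq (u : nat -> M) := [set v | ubounded v /\ udist u v = 0].

(** An element is a whole class of sequences, with the mere existence of a representative: elements
    at distance zero are then equal, as a metric demands. [urep] picks a representative by
    choice. *)
Record upower := UPower {
  uclass : set (nat -> M);
  uclassP : exists2 u, ubounded u & uclass = ueq u }.

Definition ucls u (bu : ubounded u) : upower :=
  @UPower (ueq u) (ex_intro2 _ _ u bu erefl).

Definition urep (a : upower) : nat -> M := projT1 (cid2 (uclassP a)).

Definition updist (a b : upower) := udist (urep a) (urep b).

Hypotheses (UU : UltraFilter U) (Uoo : \oo `<=` U) (domM : dom_nested).

Lemma urep_bounded a : ubounded (urep a).
Proof. by rewrite /urep; case: cid2. Qed.
Hint Resolve urep_bounded : core.

Lemma urepE a : uclass a = ueq (urep a).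
Proof. by rewrite /urep; case: cid2. Qed.

Lemma uclass_bounded a u : uclass a u -> ubounded u.
Proof. by rewrite urepE => -[]. Qed.

Lemma udist_cvg u v : ubounded u -> ubounded v ->
  mdist (u i) (v i) @[i --> U] --> udist u v.
Proof.
move=> [k ku] [l lv]; apply: (@ultrafilter_bounded_cvg _ _ U UU _ (mbound L k l)).
by move=> i; rewrite ger0_norm ?mdist_ge0//; exact: dom_bounded.
Qed.

Lemma udist_unique u v l : mdist (u i) (v i) @[i --> U] --> l -> udist u v = l.
Proof. by move=> uvl; apply: cvg_lim => //; exact: Rhausdorff. Qed.

Lemma udist_le u v e : ubounded u -> ubounded v ->
  (\forall i \near U, mdist (u i) (v i) <= e) -> udist u v <= e.
Proof. by move=> bu bv uve; apply: cvgr_to_le (udist_cvg bu bv) uve. Qed.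

Lemma udist_lt u v e : ubounded u -> ubounded v ->
  udist u v < e -> \forall i \near U, mdist (u i) (v i) < e.
Proof. by move=> bu bv uve; apply: cvgr_lt (udist_cvg bu bv) _ uve. Qed.

Lemma udist_ge0 u v : ubounded u -> ubounded v -> 0 <= udist u v.
Proof.
move=> bu bv; apply: cvgr_to_ge (udist_cvg bu bv) _.
by apply: filterE => i; exact: mdist_ge0.
Qed.

Lemma udistxx u : udist u u = 0.
Proof.
apply: udist_unique; rewrite (_ : (fun i => _) = cst 0) ?cst_cvg//; last first.
  by apply/funext => i; rewrite mdistxx.
exact: cvg_cst.
Qed.

Lemma udistC u v : udist u v = udist v u.
Proof. by rewrite /udist; under eq_fun do rewrite metric_sym. Qed.

Lemma udist_triangle v u w : ubounded u -> ubounded v -> ubounded w ->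
  udist u w <= udist u v + udist v w.
Proof.
move=> bu bv bw; apply/ler_addgt0Pl => e e0; apply: udist_le => //.
have e20 : 0 < e / 2 by rewrite divr_gt0.
have uv := @udist_lt u v (udist u v + e / 2) bu bv ltac:(by rewrite ltrDl).
have vw := @udist_lt v w (udist v w + e / 2) bv bw ltac:(by rewrite ltrDl).
apply: filterS2 uv vw => i uv vw.
rewrite (le_trans (metric_triangle _ (v i) _))// (le_trans (ltW (ltrD uv vw)))//.
by rewrite addrACA -splitr addrC.
Qed.

Lemma udist_eq0_trans v u w : ubounded u -> ubounded v -> ubounded w ->
  udist u v = 0 -> udist v w = 0 -> udist u w = 0.
Proof.
move=> bu bv bw uv vw; apply/eqP; rewrite eq_le udist_ge0// andbT.
by rewrite (le_trans (udist_triangle bu bv bw))// uv vw addr0.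
Qed.

Lemma upower_eq (a b : upower) : uclass a = uclass b -> a = b.
Proof.
case: a b => [A PA] [B PB] /= AB; case: _ / AB in PB *.
by rewrite (Prop_irrelevance PA PB).
Qed.

Lemma updist_uclass a b u v : uclass a u -> uclass b v ->
  updist a b = udist u v.
Proof.
rewrite !urepE => -[bu au] [bv bv0]; apply/eqP; rewrite eq_le; apply/andP; split.
  rewrite (le_trans (udist_triangle _ bu _))// au add0r.
  by rewrite (le_trans (udist_triangle _ bv _))// (udistC v) bv0 addr0.
rewrite (le_trans (udist_triangle bu (urep_bounded a) bv))// udistC au add0r.
by rewrite (le_trans (udist_triangle _ (urep_bounded b) _))// bv0 addr0.
Qed.

Lemma updist_eq0 a b : updist a b = 0 -> a = b.
Proof.
move=> ab; apply: upower_eq; rewrite !urepE; apply/seteqP; split => u [bu au].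
  by split => //; apply: udist_eq0_trans (urep_bounded a) _ _ au => //; rewrite udistC.
by split => //; apply: udist_eq0_trans (urep_bounded b) _ _ au.
Qed.

Lemma updist_triangle b a c : updist a c <= updist a b + updist b c.
Proof. exact: udist_triangle. Qed.

Definition upower_metric : metricType R :=
  dist_metric (fun a => udistxx (urep a)) updist_eq0
    (fun a b => udistC (urep a) (urep b)) updist_triangle.

(** Some representative has to stay in D_k; the chosen [urep] may lie in another domain. *)
Definition udom k : set upower_metric :=
  [set a | exists2 u, uclass a u & forall i, dom k (u i)].

Lemma uclass_urep a : uclass a (urep a).
Proof. by rewrite urepE; split => //; exact: udistxx. Qed.

Lemma uclass_ucls u (bu : ubounded u) : uclass (ucls bu) u.
Proof. by split => //; exact: udistxx. Qed.

Lemma udom_neq0 k : udom k !=set0.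
Proof.
have [x kx] := dom_neq0 M k.
have bx : ubounded (fun=> x) by exists k.
by exists (ucls bx), (fun=> x) => //; exact: uclass_ucls.
Qed.

Lemma udom_cover a : exists k, udom k a.
Proof.
by have [k ka] := urep_bounded a; exists k, (urep a) => //; exact: uclass_urep.
Qed.

Lemma udom_bounded j k (a b : upower_metric) : udom j a -> udom k b ->
  mdist a b <= mbound L j k.
Proof.
move=> [u au ju] [v bv kv]; rewrite dist_metricE (updist_uclass au bv).
apply: udist_le; [exact: uclass_bounded au|exact: uclass_bounded bv|].
by apply: filterE => i; exact: dom_bounded.
Qed.

Lemma near_ultra_ge N : \forall i \near U, (N <= i)%N.
Proof. by apply: Uoo; exact: nbhs_infty_ge. Qed.

(* The limit of a Cauchy sequence is the class of a diagonal: at index i it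
   follows the best of the first i representatives which are, at i, as close
   to the preceding ones as they are in the limit. *)
Lemma udom_complete k (a : nat -> upower_metric) : (forall n, udom k (a n)) ->
  cauchy (a @ \oo) -> exists2 l, udom k l & a @ \oo --> l.
Proof.
move=> ka ca.
have /choice[u_ u_a] n : exists u, uclass (a n) u /\ forall i, dom k (u i).
  by have [u ? ?] := ka n; exists u.
have bu n : ubounded (u_ n) by exists k => i; exact: (u_a n).2.
pose eps n : R := n.+1%:R^-1.
have eps0 n : 0 < eps n by rewrite invr_gt0.
have [N_ NP] := choice (fun n => cauchy_seq_mdist ca (eps0 n)).
(* The sum dominates [N_ m] for every m <= n, so [y] picks terms such that all [y l] with l >= m are
   within [eps m] of [y m]. *)
pose s n := (\sum_(j < n.+1) N_ j)%N.
have sN m n : (m <= n)%N -> (N_ m <= s n)%N.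
  by move=> mn; rewrite /s (bigD1 (inord m))//= inordK ?ltnS// leq_addr.
pose y n := u_ (s n).
have ydist m l : (m <= l)%N -> udist (y m) (y l) < eps m.
  move=> ml; rewrite -(updist_uclass (u_a (s m)).1 (u_a (s l)).1).
  by apply: (NP m); exact: sN.
pose good n i := forall m l, (m <= l)%N -> (l <= n)%N ->
  mdist (y m i) (y l i) < eps m.
have good_near n : \forall i \near U, good n i.
  have : \forall i \near U, forall m l : 'I_n.+1, (m <= l)%N ->
      mdist (y m i) (y l i) < eps m.
    apply: filter_forall => m; apply: filter_forall => l.
    case: (leqP m l) => ml; last by apply: (@filterE _ U).
    by apply: filterS (udist_lt (bu _) (bu _) (ydist _ _ ml)).
  apply: filterS => i H m l ml ln.
  have mn := leq_trans ml ln.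
  by have := H (Ordinal (mn : (m < n.+1)%N)) (Ordinal (ln : (l < n.+1)%N)) ml.
(* Index 0 is always good, so for each i there is a largest good index up to i. *)
have good0 i : good 0%N i.
  move=> m l ml; rewrite leqn0 => /eqP l0; move: ml; rewrite l0 leqn0 => /eqP ->.
  by rewrite mdistxx.
have /choice[g gP] i : exists gi,
    good gi i /\ forall n, (n <= i)%N -> good n i -> (n <= gi)%N.
  have ex : exists n, `[< good n i >] && (n <= i)%N.
    by exists 0%N; rewrite leq0n andbT; exact/asboolP.
  case: (ex_maxnP ex (m := i)) => [n /andP[]//|n /andP[/asboolP gn _] nmax].
  by exists n; split => // m mi gm; apply: nmax; rewrite mi andbT; exact/asboolP.
pose z i := y (g i) i.
have kz i : dom k (z i) by exact: (u_a _).2.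
have bz : ubounded z by exists k.
have zy m : udist (y m) z <= eps m.
  apply: (udist_le (bu _) bz).
  apply: filterS2 (good_near m) (near_ultra_ge m) => i gm mi.
  have [gi gmax] := gP i; apply/ltW/gi => //; exact: gmax.
exists (ucls bz); first by exists z => //; exact: uclass_ucls.
apply: cvg_seq_mdist => e e0.
have [m me] : exists m, eps m + eps m <= e.
  have e20 : 0 < e / 2 by rewrite divr_gt0.
  have [m] := ltr_add_invr e20.
  by rewrite add0r => me; exists m; rewrite (splitr e) lerD// ltW.
exists (N_ m) => p mp; apply: lt_le_trans me.
rewrite (le_lt_trans (metric_triangle _ (a (s m)) _))//.
apply: ler_ltD; last by apply: (NP m) => //; exact: sN.
rewrite metric_sym dist_metricE (updist_uclass (u_a (s m)).1 (uclass_ucls bz)).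
exact: zy.
Qed.

Lemma ufint_bounded (f : fsym L) (w : 'I_(arity f) -> nat -> M) :
  (forall j, ubounded (w j)) -> ubounded (fun i => fint (fun j => w j i)).
Proof.
move=> bw; pose k j := projT1 (cid (bw j)).
exists (fdom k) => i; apply: fint_dom => j; exact: (projT2 (cid (bw j))).
Qed.

Definition ufint (f : fsym L) (a : 'I_(arity f) -> upower_metric) : upower_metric :=
  ucls (ufint_bounded (fun j => urep_bounded (a j))).

Lemma uclass_ufint (f : fsym L) (a : 'I_(arity f) -> upower_metric)
    (w : 'I_(arity f) -> nat -> M) :
  (forall j, uclass (a j) (w j)) ->
  uclass (ufint a) (fun i => fint (fun j => w j i)).
Proof.
move=> aw; have bw j := uclass_bounded (aw j).
split; first exact: ufint_bounded.
have bf := ufint_bounded bw.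
have bfa := ufint_bounded (fun j => urep_bounded (a j)).
apply/eqP; rewrite eq_le udist_ge0// andbT; apply/ler_addgt0Pl => e e0.
rewrite addr0; apply: udist_le => //.
(* A modulus is stated for one tuple of domains, so both representatives of each argument are moved
   to the larger of their two domains. *)
pose k j := maxn (projT1 (cid (bw j))) (projT1 (cid (urep_bounded (a j)))).
have wk i j : dom (k j) (w j i).
  by apply: domM (projT2 (cid (bw j)) i); exact: leq_maxl.
have ak i j : dom (k j) (urep (a j) i).
  by apply: domM (projT2 (cid (urep_bounded (a j))) i); exact: leq_maxr.
have : \forall i \near U, forall j, mdist (urep (a j) i) (w j i) < fmod k e.
  apply: filter_forall => j; apply: udist_lt => //.
  by rewrite -(updist_uclass (uclass_urep _) (aw j)) /updist udistxx fmod_gt0.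
by apply: filterS => i H; exact: fint_unif.
Qed.

Lemma ufint_dom (f : fsym L) (k : 'I_(arity f) -> nat)
    (a : 'I_(arity f) -> upower_metric) :
  (forall i, udom (k i) (a i)) -> udom (fdom k) (ufint a).
Proof.
move=> ka; pose w j := projT1 (cid2 (ka j)).
have wa j : uclass (a j) (w j) by rewrite /w; case: cid2.
have wk j i : dom (k j) (w j i) by rewrite /w; case: cid2.
by exists (fun i => fint (fun j => w j i)) => [|i];
  [exact: uclass_ufint|exact: fint_dom].
Qed.

Lemma ufint_unif (f : fsym L) (k : 'I_(arity f) -> nat) (e : R)
    (a b : 'I_(arity f) -> upower_metric) :
  0 < e -> (forall i, udom (k i) (a i)) -> (forall i, udom (k i) (b i)) ->
  (forall i, mdist (a i) (b i) < fmod k e) -> mdist (ufint a) (ufint b) <= e.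
Proof.
move=> e0 ka kb abe; pose w j := projT1 (cid2 (ka j)).
have wa j : uclass (a j) (w j) by rewrite /w; case: cid2.
have wk j i : dom (k j) (w j i) by rewrite /w; case: cid2.
pose w' j := projT1 (cid2 (kb j)).
have wb j : uclass (b j) (w' j) by rewrite /w'; case: cid2.
have wk' j i : dom (k j) (w' j i) by rewrite /w'; case: cid2.
rewrite dist_metricE (updist_uclass (uclass_ufint wa) (uclass_ufint wb)).
apply: udist_le.
- by apply: ufint_bounded => j; exact: uclass_bounded (wa j).
- by apply: ufint_bounded => j; exact: uclass_bounded (wb j).
have : \forall i \near U, forall j, mdist (w j i) (w' j i) < fmod k e.
  apply: filter_forall => j; apply: udist_lt.
  - exact: uclass_bounded (wa j).
  - exact: uclass_bounded (wb j).
  by rewrite -(updist_uclass (wa j) (wb j)); exact: abe.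
by apply: filterS => i H; exact: fint_unif.
Qed.

Definition ultrapower : structure L :=
  @Structure R L upower_metric udom udom_neq0 udom_cover udom_complete
    udom_bounded ufint ufint_dom ufint_unif.

Lemma uclass_teval n (t : term L n) (v : 'I_n -> nat -> M)
    (a : 'I_n -> ultrapower) :
  (forall j, uclass (a j) (v j)) ->
  uclass (teval a t) (fun i => teval (fun j => v j i) t).
Proof.
by move=> av; elim: t => [j|f args IH] /=; [exact: av|exact: uclass_ufint].
Qed.

(* The values of [F] at witnesses which are optimal up to 1/(i+1) at index i
   converge to the supremum. *)
Lemma ultrapower_sup (F : nat -> M -> R) (G : ultrapower -> R) k :
  (forall i, has_sup (F i @` dom k)) ->
  (forall c w, uclass c w -> (forall i, dom k (w i)) ->
    F i (w i) @[i --> U] --> G c) ->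
  sup (F i @` dom k) @[i --> U] --> sup (G @` dom k).
Proof.
move=> supF FG; pose s i := sup (F i @` dom k).
have /choice[w wP] i : exists x, dom k x /\ s i - i.+1%:R^-1 < F i x.
  have i0 : 0 < i.+1%:R^-1 :> R by rewrite invr_gt0.
  by have [_ [x kx <-] xs] := sup_adherent i0 (supF i); exists x.
have bw : ubounded w by exists k => i; exact: (wP i).1.
pose c : ultrapower := ucls bw.
have cw : F i (w i) @[i --> U] --> G c.
  by apply: FG => [|i]; [exact: uclass_ucls|exact: (wP i).1].
have kc : dom k c by exists w => [|i]; [exact: uclass_ucls|exact: (wP i).1].
have inv0 : i.+1%:R^-1 @[i --> U] --> (0 : R).
  by apply: cvg_trans (@cvg_harmonic R) => A oA; exact: Uoo.
have sc : s i @[i --> U] --> G c.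
  apply: (@squeeze_cvgr _ _ _ _ (fun i => F i (w i)) (fun i => F i (w i) + i.+1%:R^-1)).
  - apply: filterE => i; apply/andP; split.
      by apply: sup_upper_bound => //; exists (w i) => //; exact: (wP i).1.
    by rewrite -lerBlDr ltW// (wP i).2.
  - exact: cw.
  - by rewrite -[X in _ --> X]addr0; exact: cvgD.
have Gc d : dom k d -> G d <= G c.
  move=> [u du ku]; apply: (ler_cvg_to (FG d u du ku) sc).
  by apply: filterE => i; apply: sup_upper_bound => //; exists (u i).
rewrite (_ : sup (G @` dom k) = G c)//; apply/eqP; rewrite eq_le; apply/andP; split.
  by apply: ge_sup => [|_ [d kd <-]]; [exists (G c), c|exact: Gc].
apply: sup_upper_bound; last by exists c.
by split; [exists (G c), c|exists (G c) => _ [d kd <-]; exact: Gc].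
Qed.

Lemma inf_image (T : Type) (F : T -> R) (A : set T) :
  inf (F @` A) = - sup ((fun x => - F x) @` A).
Proof. by rewrite /inf image_comp. Qed.

Lemma feval_image_bounded n k (psi : formula L n.+1) (v : 'I_n -> M) :
  exists B, forall x, dom k x -> `|feval psi (vcons x v)| <= B.
Proof.
pose l i := projT1 (cid (dom_cover (v i))).
have [B psiB] := feval_bounded M psi (vcons k l); exists B => x kx; apply: psiB.
by apply: vcons_ind => // i; exact: (projT2 (cid (dom_cover (v i)))).
Qed.

Lemma bounded_has_sup (T : Type) (F : T -> R) (A : set T) (B : R) :
  A !=set0 -> (forall x, A x -> `|F x| <= B) ->
  has_sup (F @` A) /\ has_sup ((fun x => - F x) @` A).
Proof.
move=> [x0 Ax0] FB; split; split.
- by exists (F x0), x0.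
- by exists B => _ [x Ax <-]; have := FB x Ax; rewrite ler_norml => /andP[].
- by exists (- F x0), x0.
- by exists B => _ [x Ax <-]; have := FB x Ax; rewrite ler_norml lerNl => /andP[].
Qed.

(** Arbitrary representatives are allowed for the parameters: this lets the quantifier cases insert
    near-optimal witness sequences of their own choice. *)
Theorem los n (phi : formula L n) (v : 'I_n -> nat -> M) (a : 'I_n -> ultrapower) :
  (forall j, uclass (a j) (v j)) ->
  feval phi (fun j => v j i) @[i --> U] --> feval phi a.
Proof.
have feval_vcons n' (psi : formula L n'.+1) (v' : 'I_n' -> nat -> M) w
    (c : ultrapower) (a' : 'I_n' -> ultrapower) :
    (forall (v : 'I_n'.+1 -> nat -> M) (a : 'I_n'.+1 -> ultrapower),
      (forall j, uclass (a j) (v j)) ->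
      feval psi (fun j => v j i) @[i --> U] --> feval psi a) ->
    uclass c w -> (forall j, uclass (a' j) (v' j)) ->
    feval psi (vcons (w i) (fun j => v' j i)) @[i --> U] -->
      feval psi (vcons c a').
  move=> IH cw av'; have /= := IH (vcons w v') (vcons c a').
  under eq_fun do
    rewrite -[fun j => vcons w v' j _]/((fun f => f _) \o vcons w v') map_vcons.
  by apply; exact: (vcons_ind (P := uclass)).
elim: phi v a => {n} [n s t|n m u cu phis IH|n k psi IH|n k psi IH] v a av /=.
- rewrite dist_metricE (updist_uclass (uclass_teval s av) (uclass_teval t av)).
  by apply: udist_cvg; apply: uclass_bounded (uclass_teval _ av).
- pose x i j := feval (phis j) (fun j => v j i).
  have xrow : \row_j x i j @[i --> U] --> \row_j feval (phis j) a.
    by apply: cvg_rowP => j; rewrite mxE; exact: IH.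
  exact: (cvg_comp _ _ xrow (cu _)).
- apply: ultrapower_sup => [i|c w cw _]; last exact: feval_vcons.
  have [B psiB] := feval_image_bounded k psi (fun j => v j i).
  exact: (bounded_has_sup (dom_neq0 M k) psiB).1.
- under eq_fun do rewrite inf_image; rewrite inf_image; apply: cvgN.
  apply: ultrapower_sup => [i|c w cw _]; last by apply: cvgN; exact: feval_vcons.
  have [B psiB] := feval_image_bounded k psi (fun j => v j i).
  exact: (bounded_has_sup (dom_neq0 M k) psiB).2.
Qed.

End Ultrapower.

(** * Algebras of continuous functions *)

Section ComplexModulus.
Context {R : realType}.
Implicit Types z w : Cplx R.

Lemma normc_norm z : `|z| = ((normc z)%:C)%C :> R[i].
Proof. by case: z. Qed.

Lemma normc_ge0 z : 0 <= normc z.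
Proof. by case: z => a b; exact: sqrtr_ge0. Qed.

Lemma normc_triangle w z (x : Cplx R) : normc (z - x) <= normc (z - w) + normc (w - x).
Proof. by rewrite -lecR (rmorphD (@real_complex R)) -!normc_norm; exact: ler_distD. Qed.

Lemma normc_add z w : normc (z + w) <= normc z + normc w.
Proof. by rewrite -lecR (rmorphD (@real_complex R)) -!normc_norm; exact: ler_normD. Qed.

Lemma normc_opp z : normc (- z) = normc z.
Proof. by case: z => a b /=; rewrite !sqrrN. Qed.

Lemma normc_distC z w : normc (z - w) = normc (w - z).
Proof. by rewrite -normc_opp opprB. Qed.

Lemma normc_mul z w : normc (z * w) = normc z * normc w.
Proof. exact: normcM. Qed.

Lemma normc_conj z : normc ((z : R[i])^*) = normc z.
Proof. by case: z => a b /=; rewrite sqrrN. Qed.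

Lemma normc_eq0 z : normc z = 0 -> z = 0.
Proof. exact: eq0_normc. Qed.

Lemma normc_zero : normc (0 : Cplx R) = 0.
Proof. exact: normc0. Qed.

Lemma normc_one : normc (1 : Cplx R) = 1.
Proof. exact: normc1. Qed.

Lemma normc_natr (k : nat) : normc (k%:R : Cplx R) = k%:R.
Proof. 
apply: (@complexI R); rewrite -normc_norm.
by rewrite normr_nat rmorph_nat.
Qed.

(** The topology of [R[i]] is stated with radii in [R[i]]. A positive radius is real, because the
    order compares only numbers with equal imaginary parts, so real radii suffice. *)
Lemma normc_cvgP (T : Type) (F : set_system T) (FF : Filter F) (f : T -> Cplx R)
    (l : Cplx R) :
  f @ F --> l <-> forall e : R, 0 < e -> \forall t \near F, normc (l - f t) < e.
Proof.
split => [/cvgrPdist_lt fl e e0|fl].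
  have : (0 : R[i]) < (e%:C)%C by rewrite ltcR.
  by move/fl; apply: filterS => t; rewrite normc_norm ltcR.
apply/cvgrPdist_lt => -[e ei]; rewrite ltcE/= => /andP[/eqP -> e0].
by apply: filterS (fl e e0) => t; rewrite normc_norm ltcR.
Qed.

Lemma normc_continuous : continuous (@normc R : Cplx R -> R).
Proof.
move=> z; apply/(@cvgrPdist_lt _ R^o _ _ (nbhs_filter z)) => e e0.
have := (normc_cvgP (nbhs_filter z) id z).1 cvg_id e e0.
apply: filterS => w; apply: le_lt_trans.
rewrite ler_norml; apply/andP; split.
  rewrite lerNl opprB lerBlDr; have := normc_triangle z w 0.
  by rewrite !subr0 normc_distC.
by rewrite lerBlDr; have := normc_triangle w z 0; rewrite !subr0.
Qed.

Lemma real_cauchy_cvg (x : nat -> R) :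
  (forall e, 0 < e -> exists N, forall m n, (N <= m)%N -> (N <= n)%N ->
    `|x m - x n| < e) ->
  exists l, forall e, 0 < e -> exists N, forall n, (N <= n)%N -> `|l - x n| < e.
Proof.
move=> cx; have : cauchy (x @ \oo).
  apply: cauchy_exP => e e0; have [N xN] := cx e e0; exists (x N), N => // n Nn.
  exact: xN.
move/cauchy_cvgP => /cvg_ex[l /cvgrPdist_lt xl].
by exists l => e e0; have [N _ lN] := xl e e0; exists N.
Qed.

Lemma complex_cauchy_cvg (z : nat -> Cplx R) :
  (forall e : R, 0 < e -> exists N, forall m n, (N <= m)%N -> (N <= n)%N ->
    normc (z m - z n) < e) ->
  exists l : Cplx R, forall e : R, 0 < e -> exists N, forall n, (N <= n)%N ->
    normc (l - z n) < e.
Proof.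
move=> cz.
have ReB (u v : R[i]) : complex.Re u - complex.Re v = complex.Re (u - v).
  by case: u v => [? ?] [? ?].
have ImB (u v : R[i]) : complex.Im u - complex.Im v = complex.Im (u - v).
  by case: u v => [? ?] [? ?].
have ReC (u : R[i]) : `|complex.Re u| <= normc u.
  by case: u => a b /=; rewrite -sqrtr_sqr ler_sqrt ?addr_ge0 ?sqr_ge0// lerDl sqr_ge0.
have ImC (u : R[i]) : `|complex.Im u| <= normc u.
  by case: u => a b /=; rewrite -sqrtr_sqr ler_sqrt ?addr_ge0 ?sqr_ge0// lerDr sqr_ge0.
have ReImC (u : R[i]) : normc u <= `|complex.Re u| + `|complex.Im u|.
  case: u => a b /=; rewrite -[leRHS]ger0_norm ?addr_ge0// -sqrtr_sqr.
  rewrite ler_sqrt ?sqr_ge0// sqrrD !real_normK ?num_real// [leRHS]addrAC lerDl.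
  by rewrite mulrn_wge0// mulr_ge0.
have [|p pP] := @real_cauchy_cvg (fun n => complex.Re (z n)).
  move=> e e0; have [N zN] := cz e e0; exists N => m n Nm Nn.
  by rewrite ReB (le_lt_trans (ReC _))//; exact: zN.
have [|q qP] := @real_cauchy_cvg (fun n => complex.Im (z n)).
  move=> e e0; have [N zN] := cz e e0; exists N => m n Nm Nn.
  by rewrite ImB (le_lt_trans (ImC _))//; exact: zN.
exists (p +i* q)%C => e e0.
have e20 : 0 < e / 2 by rewrite divr_gt0.
have [N1 N1P] := pP _ e20; have [N2 N2P] := qP _ e20.
exists (maxn N1 N2) => n; rewrite geq_max => /andP[n1 n2].
rewrite (le_lt_trans (ReImC _))// -ReB -ImB/= (splitr e) ltrD//; first exact: N1P.
exact: N2P.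
Qed.

End ComplexModulus.

(** * The metric space C(X) for compact X *)

Section ContinuousFunctions.
Context {R : realType} (X : topologicalType).
Local Notation C := (Cplx R).
Implicit Types f g : X -> C.

Lemma continuous_normcP f : continuous f <->
  forall x e, 0 < e -> \forall y \near x, normc (f x - f y) < e.
Proof.
by split => cf x; [exact: (normc_cvgP (nbhs_filter x) f (f x)).1 (cf x)|
                   exact: (normc_cvgP (nbhs_filter x) f (f x)).2 (cf x)].
Qed.

Lemma continuous_addf f g : continuous f -> continuous g ->
  continuous (fun x => f x + g x : C).
Proof. by move=> cf cg x; apply: (@cvgD _ C^o); [exact: cf|exact: cg]. Qed.

Lemma continuous_mulf f g : continuous f -> continuous g ->
  continuous (fun x => f x * g x : C).
Proof. by move=> cf cg x; apply: (@cvgM C); [exact: cf|exact: cg]. Qed.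

Lemma continuous_invf f : (forall x, f x != 0) -> continuous f ->
  continuous (fun x => (f x)^-1 : C).
Proof. by move=> f0 cf x; apply: (@cvgV C); [exact: f0|exact: cf]. Qed.

Lemma continuous_conjf f : continuous f ->
  continuous (fun x => (f x : R[i])^* : C).
Proof.
move=> /continuous_normcP cf; apply/continuous_normcP => x e e0.
by apply: filterS (cf x e e0) => y; rewrite -rmorphB normc_conj.
Qed.

Lemma continuous_cstf (z : C) : continuous (fun _ : X => z).
Proof. by move=> x; exact: cvg_cst. Qed.

Lemma continuous_clopen_if (V : set X) f g : clopen V ->
  continuous f -> continuous g ->
  continuous (fun x => if x \in V then f x else g x).
Proof.
move=> [oV cV] cf cg; apply/continuous_normcP => x e e0.
case: ifPn => [|]; rewrite ?inE ?notin_setE => xV.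
  have := (continuous_normcP f).1 cf x e e0.
  apply: filterS2 (open_nbhs_nbhs (conj oV xV)) => y Vy.
  by rewrite mem_set.
have oVC : open (~` V) by exact: closed_openC.
have := (continuous_normcP g).1 cg x e e0.
apply: filterS2 (open_nbhs_nbhs (conj oVC xV)) => y Vy.
by rewrite memNset.
Qed.

Hypothesis cX : compact [set: X].

Lemma compact_normc_bounded f : continuous f ->
  exists B, forall x, normc (f x) <= B.
Proof.
move=> cf; have [[x0 _]|X0] := pselect (@setT X !=set0); last first.
  by exists 0 => x; exfalso; apply: X0; exists x.
have cn : {within setT, continuous (fun x => normc (f x))}.
  apply: continuous_subspaceT => x.
  by apply: continuous_comp; [exact: cf|exact: normc_continuous].
have [c _ cmax] := compact_EVT_max (ex_intro _ x0 I) cX cn.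
by exists (normc (f c)) => x; apply: cmax; rewrite inE.
Qed.

Record cfun := CFun { cfun_fun :> X -> C; cfun_continuous : continuous cfun_fun }.

Lemma cfun_eq (a b : cfun) : cfun_fun a = cfun_fun b -> a = b.
Proof.
case: a b => [f cf] [g cg] /= fg; subst g.
by rewrite (Prop_irrelevance cf cg).
Qed.

Definition cfdist (a b : cfun) : R :=
  sup [set normc (a x - b x) | x in [set: X]].

Lemma cfdist_ub (a b : cfun) x : normc (a x - b x) <= cfdist a b.
Proof.
have [B aB] := compact_normc_bounded (@cfun_continuous a).
have [D bD] := compact_normc_bounded (@cfun_continuous b).
apply: ub_le_sup; last by exists x.
exists (B + D) => _ [y _ <-].
by rewrite (le_trans (normc_add _ _))// normc_opp lerD.
Qed.

(** The condition 0 <= e covers an empty [X], where the supremum has the default value 0. *)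
Lemma cfdist_le (a b : cfun) e : 0 <= e ->
  (forall x, normc (a x - b x) <= e) -> cfdist a b <= e.
Proof.
move=> e0 abe; have [[x0 _]|X0] := pselect (@setT X !=set0).
  by apply: ge_sup => [|_ [x _ <-]//]; exists (normc (a x0 - b x0)), x0.
rewrite /cfdist (_ : [set _ | _ in _] = set0) ?sup0//.
by apply/seteqP; split => // r [x _ _]; apply: X0; exists x.
Qed.

Lemma cfdist_ge0 (a b : cfun) : 0 <= cfdist a b.
Proof.
have [[x0 _]|X0] := pselect (@setT X !=set0).
  by rewrite (le_trans _ (cfdist_ub a b x0))// normc_ge0.
rewrite /cfdist (_ : [set _ | _ in _] = set0) ?sup0//.
by apply/seteqP; split => // r [x _ _]; apply: X0; exists x.
Qed.

Lemma cfdistxx a : cfdist a a = 0.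
Proof.
apply/eqP; rewrite eq_le cfdist_ge0 andbT; apply: cfdist_le => // x.
by rewrite subrr normc_zero.
Qed.

Lemma cfdist_eq0 a b : cfdist a b = 0 -> a = b.
Proof.
move=> ab; apply/cfun_eq/funext => x; apply/eqP; rewrite -subr_eq0; apply/eqP.
apply: normc_eq0; apply/eqP; rewrite eq_le normc_ge0 andbT -ab; exact: cfdist_ub.
Qed.

Lemma cfdistC a b : cfdist a b = cfdist b a.
Proof. by rewrite /cfdist; congr sup; apply: eq_imagel => x _; rewrite normc_distC. Qed.

Lemma cfdist_triangle b a c : cfdist a c <= cfdist a b + cfdist b c.
Proof.
apply: cfdist_le => [|x]; first by rewrite addr_ge0// cfdist_ge0.
by rewrite (le_trans (normc_triangle (b x) _ _))// lerD// cfdist_ub.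
Qed.

Definition cfun_metric : metricType R :=
  dist_metric cfdistxx cfdist_eq0 cfdistC cfdist_triangle.

Definition cball (k : nat) : set cfun_metric :=
  [set a : cfun | forall x, normc (a x) <= k%:R].

Lemma cball_neq0 k : cball k !=set0.
Proof.
exists (CFun (@continuous_cstf 0)) => x.
by rewrite (_ : normc _ = 0) ?ler0n//; exact: normc_zero.
Qed.

Lemma cball_cover a : exists k, cball k a.
Proof.
have [B aB] := compact_normc_bounded (@cfun_continuous a).
exists `|Num.ceil B|%N => x; rewrite (le_trans (aB x))//.
by rewrite (le_trans (ceil_ge _))// natr_absz ler_int ler_norm.
Qed.

Lemma cball_bounded j k (a b : cfun_metric) : cball j a -> cball k b ->
  mdist a b <= (j + k)%:R.
Proof.
move=> ja kb; rewrite dist_metricE; apply: cfdist_le => // x.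
by rewrite (le_trans (normc_add _ _))// normc_opp natrD lerD.
Qed.

Lemma cball_complete k (a : nat -> cfun_metric) : (forall n, cball k (a n)) ->
  cauchy (a @ \oo) -> exists2 l, cball k l & a @ \oo --> l.
Proof.
move=> ka ca.
have ca' := cauchy_seq_mdist ca.
have /choice[l lP] x : exists l : C, forall e : R, 0 < e ->
    exists N, forall n, (N <= n)%N -> normc (l - (a n : cfun) x) < e.
  apply: complex_cauchy_cvg => e e0; have [N aN] := ca' e e0.
  exists N => m n Nm Nn; apply: le_lt_trans (aN m n Nm Nn); exact: cfdist_ub.
(* The pointwise limits are approached uniformly: at each x the comparison goes through a term late
   enough for x, while N depends on e alone. *)
have lU e : 0 < e -> exists N, forall n, (N <= n)%N ->
    forall x, normc (l x - (a n : cfun) x) <= e.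
  move=> e0; have [N aN] := ca' e e0; exists N => n Nn x.
  apply/ler_addgt0Pl => d d0; have [K lK] := lP x d d0.
  rewrite (le_trans (normc_triangle ((a (maxn N K) : cfun) x) _ _))// lerD//.
    by apply/ltW/lK; exact: leq_maxr.
  apply: le_trans (ltW (aN (maxn N K) n (leq_maxl _ _) Nn)); exact: cfdist_ub.
have cl : continuous l.
  apply/continuous_normcP => x e e0.
  have e30 : 0 < e / 3 by rewrite divr_gt0.
  have [N lN] := lU _ e30; have := lN N (leqnn N) => {}lN.
  have := (continuous_normcP _).1 (@cfun_continuous (a N)) x _ e30.
  apply: filterS => y aNy.
  rewrite (le_lt_trans (normc_triangle ((a N : cfun) x) _ _))//.
  rewrite (le_lt_trans (lerD (lN x) (normc_triangle ((a N : cfun) y) _ _)))//.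
  have e3 : e = e / 3 + (e / 3 + e / 3) by field.
  by rewrite [ltRHS]e3 ltrD2l ltr_leD// normc_distC.
exists (CFun cl).
  move=> x /=; apply/ler_addgt0Pl => e e0; have [N lN] := lU e e0.
  have := normc_triangle ((a N : cfun) x) (l x) 0; rewrite !subr0 => /le_trans; apply.
  by rewrite lerD// ?lN//; exact: ka.
apply: cvg_seq_mdist => e e0.
have e20 : 0 < e / 2 by rewrite divr_gt0.
have [N lN] := lU _ e20; exists N => n Nn.
rewrite dist_metricE (@le_lt_trans _ _ (e / 2))// ?ltr_pdivrMr ?ltr_pMr ?ltr1n//.
by apply: cfdist_le => [|x]; [exact: ltW|exact: lN].
Qed.

End ContinuousFunctions.

Section FunctionAlgebra.
Context {R : realType} {M : structure (L_cstar R)} {X : topologicalType}.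
Context {Phi : M -> X -> Cplx R}.
Hypotheses (cX : compact [set: X]) (iM : iso_CX Phi).

Lemma iso_dist_ub a b x : normc (Phi a x - Phi b x) <= mdist a b.
Proof.
rewrite (CX_dist iM).
exact: (cfdist_ub cX (CFun (CX_continuous iM (a := a)))
  (CFun (CX_continuous iM (a := b)))).
Qed.

Lemma iso_dist_le a b e : 0 <= e -> (forall x, normc (Phi a x - Phi b x) <= e) ->
  mdist a b <= e.
Proof.
move=> e0 abe; rewrite (CX_dist iM).
exact: (@cfdist_le _ _ (CFun (CX_continuous iM (a := a)))
  (CFun (CX_continuous iM (a := b))) e e0 abe).
Qed.

Lemma iso_inj a b : (forall x, Phi a x = Phi b x) -> a = b.
Proof.
move=> ab; apply/mdist_positivity/eqP; rewrite eq_le mdist_ge0 andbT.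
by apply: iso_dist_le => // x; rewrite ab subrr normc_zero.
Qed.

Lemma iso_norm_ub a x : normc (Phi a x) <= cnorm a.
Proof. by have := iso_dist_ub a (czero M) x; rewrite (CX_zero iM) subr0. Qed.

Lemma iso_norm_le a e : 0 <= e -> (forall x, normc (Phi a x) <= e) -> cnorm a <= e.
Proof. by move=> e0 ae; apply: iso_dist_le => // x; rewrite (CX_zero iM) subr0. Qed.

Lemma cnorm_ge0 (a : M) : 0 <= cnorm a.
Proof. exact: mdist_ge0. Qed.

Let PhiE := (CX_zero iM, CX_one iM, CX_add iM, CX_mul iM, CX_star iM, CX_scale iM).

Lemma iso_comm_cstar : comm_cstar_algebra M.
Proof.
split.
- by move=> a b c; apply: iso_inj => x; rewrite !PhiE addrA.
- by move=> a b; apply: iso_inj => x; rewrite !PhiE addrC.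
- by move=> a; apply: iso_inj => x; rewrite !PhiE addr0.
- by move=> a; apply: iso_inj => x; rewrite !PhiE mulN1r subrr.
- by move=> z w a; apply: iso_inj => x; rewrite !PhiE mulrA.
- by move=> a; apply: iso_inj => x; rewrite !PhiE mul1r.
- by move=> z a b; apply: iso_inj => x; rewrite !PhiE mulrDr.
- by move=> z w a; apply: iso_inj => x; rewrite !PhiE mulrDl.
- by move=> a b c; apply: iso_inj => x; rewrite !PhiE mulrA.
- by move=> a b; apply: iso_inj => x; rewrite !PhiE mulrC.
- by move=> a; apply: iso_inj => x; rewrite !PhiE mulr1.
- by move=> a b c; apply: iso_inj => x; rewrite !PhiE mulrDl.
- by move=> z a b; apply: iso_inj => x; rewrite !PhiE mulrA.
- by move=> a; apply: iso_inj => x; rewrite !PhiE conjCK.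
- by move=> a b; apply: iso_inj => x; rewrite !PhiE rmorphD.
- by move=> z a; apply: iso_inj => x; rewrite !PhiE rmorphM.
- by move=> a b; apply: iso_inj => x; rewrite !PhiE rmorphM mulrC.
- move=> a b; rewrite /cnorm !(CX_dist iM); congr sup; apply: eq_imagel => x _.
  by rewrite !PhiE mulN1r subr0.
- have normZ_le z (a : M) : cnorm (cscale z a) <= normc z * cnorm a.
    apply: iso_norm_le => [|x]; first by rewrite mulr_ge0// ?normc_ge0// cnorm_ge0.
    by rewrite !PhiE normc_mul ler_wpM2l ?normc_ge0// iso_norm_ub.
  move=> z a; apply/eqP; rewrite eq_le normZ_le/=.
  have [->|z0] := eqVneq z 0; first by rewrite normc_zero mul0r cnorm_ge0.
  have nz0 : 0 < normc z.
    by rewrite lt_neqAle normc_ge0 andbT eq_sym; apply/eqP => /normc_eq0/eqP; exact/negP.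
  (* The reverse inequality is the same bound applied to the scalar z^-1 and the element z a. *)
  rewrite -ler_pdivlMl// -normcV.
  apply: le_trans (normZ_le z^-1 (cscale z a)).
  rewrite (_ : cscale z^-1 (cscale z a) = a)//.
  by apply: iso_inj => x; rewrite !PhiE mulrA mulVf// mul1r.
- move=> a b; apply: iso_norm_le => [|x]; first by rewrite mulr_ge0// cnorm_ge0.
  by rewrite !PhiE normc_mul ler_pM ?normc_ge0// iso_norm_ub.
- move=> a; apply/eqP; rewrite eq_le; apply/andP; split.
    apply: iso_norm_le => [|x]; first by rewrite sqr_ge0.
    rewrite !PhiE normc_mul normc_conj -expr2.
    by rewrite lerXn2r ?nnegrE ?normc_ge0 ?cnorm_ge0// iso_norm_ub.
  (* At each x the square of |a(x)| is the modulus of the function [cmul (cstar a) a], so |a(x)| is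
     at most the square root of its norm. *)
  rewrite -[leRHS]sqr_sqrtr ?cnorm_ge0// lerXn2r ?nnegrE ?sqrtr_ge0 ?cnorm_ge0//.
  apply: iso_norm_le => [|x]; first exact: sqrtr_ge0.
  rewrite -[leLHS]ger0_norm ?normc_ge0// -sqrtr_sqr ler_sqrt ?cnorm_ge0//.
  rewrite expr2 -[X in X * _]normc_conj -normc_mul.
  by have := iso_norm_ub (cmul (cstar a) a) x; rewrite !PhiE.
- move=> k a; rewrite (CX_dom iM); split => [ak|ak x]; first exact: iso_norm_le.
  by rewrite (le_trans (iso_norm_ub _ _)).
Qed.

End FunctionAlgebra.

(** * The structure (C(X), f |-> f o S) *)

Section SystemAlgebra.
Context {R : realType} {X : topologicalType}.
Variable S : X -> X.
Hypotheses (cX : compact [set: X]) (cS : continuous S).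
Local Notation C := (Cplx R).
Local Notation CX := (@cfun R X).
Local Notation CXm := (@cfun_metric R X cX).

Lemma continuous_comp_system (a : CX) : continuous (fun x => a (S x)).
Proof. by move=> x; apply: continuous_comp; [exact: cS|exact: cfun_continuous]. Qed.

Definition system_fint (f : fsym (L_cstar_sigma R)) : ('I_(arity f) -> CXm) -> CXm :=
  match f as g return ('I_(@arity R (L_cstar_sigma R) g) -> CXm) -> CXm with
  | Some Czero => fun=> CFun (@continuous_cstf R X 0)
  | Some Cone => fun=> CFun (@continuous_cstf R X 1)
  | Some Cadd => fun a => CFun (continuous_addf
      (@cfun_continuous R X (a ord0)) (@cfun_continuous R X (a ord_max)))
  | Some Cmul => fun a => CFun (continuous_mulf
      (@cfun_continuous R X (a ord0)) (@cfun_continuous R X (a ord_max)))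
  | Some Cstar => fun a => CFun (continuous_conjf (@cfun_continuous R X (a ord0)))
  | Some (Cscale z) => fun a => CFun (continuous_mulf
      (@continuous_cstf R X z) (@cfun_continuous R X (a ord0)))
  | None => fun a => CFun (@continuous_comp_system (a ord0))
  end.

Lemma system_fint_dom (f : fsym (L_cstar_sigma R)) (k : 'I_(arity f) -> nat)
    (a : 'I_(arity f) -> CXm) :
  (forall i, cball (k i) (a i)) -> cball (fdom k) (system_fint a).
Proof.
case: f k a => [[||||| z]|] k a ka x /=.
- by rewrite expr0n addr0 sqrtr0.
- by rewrite expr0n expr1n addr0 sqrtr1.
- by rewrite (le_trans (normc_add _ _))// natrD lerD//; exact: ka.
- by rewrite normc_mul natrM ler_pM ?normc_ge0//; exact: ka.
- by rewrite normc_conj; exact: ka.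
- rewrite normc_mul natrM ler_pM ?normc_ge0//; last exact: ka.
  by rewrite (le_trans (ceil_ge _))// natr_absz ler_int ler_norm.
- exact: ka.
Qed.

Lemma system_fint_unif (f : fsym (L_cstar_sigma R)) (k : 'I_(arity f) -> nat) (e : R)
    (a b : 'I_(arity f) -> CXm) :
  0 < e -> (forall i, cball (k i) (a i)) -> (forall i, cball (k i) (b i)) ->
  (forall i, mdist (a i) (b i) < fmod k e) ->
  mdist (system_fint a) (system_fint b) <= e.
Proof.
move=> e0 ka kb ab.
have abx i x : normc ((a i : CX) x - (b i : CX) x) <= fmod k e.
  by rewrite (le_trans (cfdist_ub cX _ _ x))// ltW//; exact: ab.
rewrite dist_metricE; apply: (cfdist_le (ltW e0)) => x.
case: f k a b ka kb ab abx => [[||||| z]|] k a b ka kb ab abx.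
- by rewrite (_ : _ - _ = 0 :> C) ?normc_zero ?ltW//; exact: subrr.
- by rewrite (_ : _ - _ = 0 :> C) ?normc_zero ?ltW//; exact: subrr.
- rewrite /= opprD addrACA (le_trans (normc_add _ _))// (splitr e) lerD//; exact: abx.
- rewrite /=; pose d : R := (k ord0 + k ord_max)%:R.
  have d0 : 0 <= d by exact: ler0n.
  have d1 : 0 < d + 1 by rewrite ltr_wpDl.
  have abx' i y : normc ((a i : CX) y - (b i : CX) y) <= e / (d + 1).
    by rewrite /d natr1; exact: abx.
  (* With both differences at most e/(d + 1) and the factors bounded by k_0 and k_1, the sum is at
     most d e/(d + 1) <= e; the 1 in the modulus avoids division by zero when d = 0. *)
  rewrite (_ : _ - _ = (a ord0 : CX) x * ((a ord_max : CX) x - (b ord_max : CX) x) +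
     ((a ord0 : CX) x - (b ord0 : CX) x) * (b ord_max : CX) x); last by ring.
  rewrite (le_trans (normc_add _ _))// !normc_mul.
  apply: (@le_trans _ _ ((k ord0)%:R * (e / (d + 1)) + (e / (d + 1)) * (k ord_max)%:R)).
    by apply: lerD; apply: ler_pM; rewrite ?normc_ge0//; [exact: ka|exact: kb].
  rewrite [X in _ + X]mulrC -mulrDl -natrD -/d mulrCA ger_pMr// ler_pdivrMr//.
  by rewrite mul1r lerDl.
- by rewrite /= -rmorphB normc_conj; exact: abx.
- rewrite /= -mulrBr normc_mul.
  have z1 : 0 < normc z + 1 by rewrite ltr_wpDl ?normc_ge0.
  apply: (@le_trans _ _ (normc z * (e / (normc z + 1)))).
    by rewrite ler_wpM2l ?normc_ge0//; exact: abx.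
  by rewrite mulrCA ger_pMr// ler_pdivrMr// mul1r lerDl.
- exact: abx.
Qed.

Definition system_algebra : structure (L_cstar_sigma R) :=
  @Structure R (L_cstar_sigma R) CXm (@cball R X cX) (@cball_neq0 R X cX)
    (@cball_cover R X cX) (@cball_complete R X cX) (@cball_bounded R X cX)
    system_fint system_fint_dom system_fint_unif.

Definition system_eval (a : system_algebra) : X -> C := cfun_fun (a : CX).

Lemma system_iso : @iso_CX R (reduct system_algebra) X system_eval.
Proof.
split => //.
- by move=> a; exact: cfun_continuous.
- by move=> f cf; exists (CFun cf).
- by move=> a b x; rewrite /system_eval /= vcons_max !vcons0.
- by move=> a b x; rewrite /system_eval /= vcons_max !vcons0.
- by move=> a x; rewrite /system_eval /= vcons0.
- by move=> a x; rewrite /system_eval /= vcons0.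
Qed.

Lemma system_evalS (a : system_algebra) x :
  system_eval (new_fun a) x = system_eval a (S x).
Proof. by rewrite /system_eval /= vcons0. Qed.

End SystemAlgebra.

Section SystemAutomorphism.
Context {R : realType} {X : topologicalType} {S S' : X -> X}.
Hypotheses (cX : compact [set: X]) (cS : continuous S) (cS' : continuous S').
Hypotheses (SK : cancel S S') (S'K : cancel S' S).
Local Notation A := (@system_algebra R X S cX cS).

Lemma system_automorphism : @star_automorphism R (reduct A) (@new_fun R (L_cstar R) A).
Proof.
have iA := system_iso (R := R) cX cS.
have injA := iso_inj iA.
have E (a : A) x := system_evalS a x.
split.
- pose s' (a : A) : A := CFun (continuous_comp_system cS' (a := (a : cfun X))).
  exists s' => a; apply: injA => x; rewrite ?E.
    by rewrite -[LHS]/(system_eval (new_fun a) (S' x)) E S'K.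
  by rewrite -[LHS]/(system_eval a (S' (S x))) SK.
- by move=> a b; apply: injA => x; rewrite (CX_add iA) !E (CX_add iA).
- by move=> z a; apply: injA => x; rewrite (CX_scale iA) !E (CX_scale iA).
- by move=> a b; apply: injA => x; rewrite (CX_mul iA) !E (CX_mul iA).
- by apply: injA => x; rewrite E !(CX_one iA).
- by move=> a; apply: injA => x; rewrite (CX_star iA) !E (CX_star iA).
Qed.

End SystemAutomorphism.

Section CantorModels.
Context {R : realType} {Tcantor : theory (L_cstar R)}
  {TcstarA : theory (L_cstar_sigma R)}.
Hypotheses (hcantor : axiomatizes_cantor Tcantor)
  (hcstarA : axiomatizes_cstar_A TcstarA).

(** The C*-identities demanded by [TcstarA] hold in any algebra isomorphic to C(X), which leaves
    only the automorphism to be recorded. *)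
Lemma models_cantor_A (M : structure (L_cstar_sigma R)) :
  models (T_cantor_A Tcantor TcstarA) M <->
  (exists2 X : topologicalType, cantor_like X &
     exists Phi : M -> X -> Cplx R, @iso_CX R (reduct M) X Phi) /\
  @star_automorphism R (reduct M) (@new_fun R (L_cstar R) M).
Proof.
have -> : models (T_cantor_A Tcantor TcstarA) M <->
    models Tcantor (reduct M) /\ models TcstarA M.
  rewrite -models_lift; split => [MT|[MT MA]].
    by split => phi Tphi; apply: MT; [left|right].
  by move=> phi [|]; [exact: MT|exact: MA].
rewrite (hcantor (reduct M)) (hcstarA M); split; first by move=> [? []].
move=> [[X xX [Phi iPhi]] aM]; split; first by exists X => //; exists Phi.
by split => //; apply: iso_comm_cstar iPhi; case: xX.
Qed.

End CantorModels.

(** * Characters of C(X) and the dual homeomorphism *)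

Section Characters.
Context {R : realType} {M : structure (L_cstar R)} {X : topologicalType}.
Context {Phi : M -> X -> Cplx R}.
Hypotheses (xX : cantor_like X) (iM : iso_CX Phi).
Local Notation C := (Cplx R).

Let cX : compact [set: X]. Proof. by case: xX. Qed.

Let PhiE := (CX_zero iM, CX_one iM, CX_add iM, CX_mul iM, CX_star iM, CX_scale iM).

Lemma iso_indicator (V : set X) : clopen V ->
  exists a, forall x, Phi a x = if x \in V then 1 else 0.
Proof.
move=> cV; have [a aE] := CX_surj iM (continuous_clopen_if cV
  (@continuous_cstf R X 1) (@continuous_cstf R X 0)).
by exists a => x; rewrite aE.
Qed.

Lemma iso_separates x y : (forall a, Phi a x = Phi a y) -> x = y.
Proof.
move=> xy; apply/eqP/negP => /negP xNy; have [_ _ _ zX] := xX.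
have [V [cV Vx Vy]] := zX x y xNy; have [a aV] := iso_indicator cV.
have := xy a; rewrite !aV mem_set// memNset// => /eqP.
by rewrite oner_eq0.
Qed.

Lemma clopen_nbhs x (V : set X) : nbhs x V -> exists2 W, clopen W /\ W x & W `<=` V.
Proof.
case: xX => _ _ hX zX /(zero_dimensional_cvg hX zX cX)[W [Wx cW] WV].
by exists W.
Qed.

(* The clopen sets whose indicator is mapped to 1 form a filter base; a
   character is the evaluation at any of its cluster points. *)
Lemma character_eval (chi : M -> C) :
  (forall a b, chi (cadd a b) = chi a + chi b) ->
  (forall a b, chi (cmul a b) = chi a * chi b) ->
  (forall z a, chi (cscale z a) = z * chi a) ->
  chi (cone M) = 1 ->
  exists y, forall a, chi a = Phi a y.
Proof.
move=> chiD chiM chiZ chi1.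
pose ind (V : set X) a := forall x, Phi a x = if x \in V then 1 else 0.
pose F := [set V : set X | exists2 a, ind V a & chi a = 1].
have indI V W a b : ind V a -> ind W b -> ind (V `&` W) (cmul a b).
  move=> aV bW x; rewrite PhiE aV bW in_setI.
  by case: (x \in V); case: (x \in W); rewrite ?(mulr1, mulr0, mul0r).
have ind_eq V a b : ind V a -> ind V b -> a = b.
  by move=> aV bV; apply: (iso_inj iM) => x; rewrite aV bV.
pose G := filter_from F id.
have GF : ProperFilter G.
  apply: filter_from_proper.
    apply: filter_from_filter.
      by exists setT, (cone M) => // x; rewrite PhiE in_setT.
    move=> V W [a aV a1] [b bW b1]; exists (V `&` W) => //.
    by exists (cmul a b); [exact: indI|rewrite chiM a1 b1 mulr1].
  move=> V [a aV a1]; apply/set0P/eqP => V0.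
  have a0 : a = cscale 0 (cone M).
    by apply: (iso_inj iM) => x; rewrite aV V0 in_set0 !PhiE mul0r.
  by move: a1; rewrite a0 chiZ mul0r => /eqP; rewrite eq_sym oner_eq0.
have [y [_ Gy]] := cX GF filterT.
(* The indicator of V is idempotent, so chi is 0 or 1 on it; the value 0 would put the complement of
   V into the filter, although y is a cluster point lying in the open set V. *)
have chiV V a : clopen V -> V y -> ind V a -> chi a = 1.
  move=> cV Vy aV; have aa : cmul a a = a.
    by apply: ind_eq (indI _ _ _ _ aV aV) _; rewrite setIid.
  have : chi a * (chi a - 1) = 0 by rewrite mulrBr mulr1 -chiM aa subrr.
  move=> /eqP; rewrite mulf_eq0 => /orP[/eqP a0|]; last by rewrite subr_eq0 => /eqP.
  have GVC : G (~` V).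
    exists (~` V) => //; exists (cadd (cone M) (cscale (-1) a)).
      move=> x; rewrite !PhiE aV in_setC.
      by case: (x \in V); rewrite /= ?(mulr1, mulr0, subrr, addr0).
    by rewrite chiD chiZ chi1 a0 mulr0 addr0.
  by have [x []] := Gy (~` V) V GVC (open_nbhs_nbhs (conj cV.1 Vy)).
(* h = a - chi(a) lies in the kernel of chi. Were h(y) nonzero, h would be invertible on a clopen W
   around y, and the indicator of W, a multiple of h, would lie in the kernel too. *)
exists y => a; pose h := cadd a (cscale (- chi a) (cone M)).
have chih : chi h = 0 by rewrite chiD chiZ chi1 mulr1 subrr.
have hy : Phi h y = Phi a y - chi a by rewrite !PhiE mulr1.
apply/eqP; rewrite eq_sym -subr_eq0 -hy; apply/negP => /negP h0.
have ch : continuous (Phi h) by exact: (CX_continuous iM).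
have [W [cW Wy] Wh] : exists2 W, clopen W /\ W y & W `<=` [set x | Phi h x != 0].
  apply: clopen_nbhs; have := (continuous_normcP _).1 ch y (normc (Phi h y)).
  move=> /(_ _)/filterS; apply; last first.
    by rewrite lt_neqAle normc_ge0 andbT eq_sym; apply/eqP => /normc_eq0/eqP; exact/negP.
  by move=> x; apply: contraTneq => ->; rewrite subr0 ltxx.
(* Replacing h by 1 off W makes it invertible everywhere, so its inverse is continuous and can then
   be cut off to W. *)
pose f x := if x \in W then Phi h x else 1.
have f0 x : f x != 0.
  by rewrite /f; case: ifPn => [|_]; [rewrite inE => /Wh|exact: oner_neq0].
have cf : continuous f :=
  continuous_clopen_if cW ch (@continuous_cstf R X 1).
have [k kE] := CX_surj iM (continuous_clopen_if cW
  (continuous_invf f0 cf) (@continuous_cstf R X 0)).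
have khW : ind W (cmul k h).
  move=> x; rewrite PhiE kE; case: ifPn => xW; rewrite ?mul0r//.
  by rewrite /f xW mulVf//; apply: Wh; rewrite -inE.
have := chiV W _ cW Wy khW; rewrite chiM chih mulr0 => /eqP.
by rewrite eq_sym oner_eq0.
Qed.

(** Applying s and then evaluating at x is a character, hence evaluation at a point S x. Continuity
    is tested on clopen sets W: their preimages under S are read off from the image under s of the
    indicator of W. *)
Lemma endomorphism_dual (s : M -> M) :
  (forall a b, s (cadd a b) = cadd (s a) (s b)) ->
  (forall a b, s (cmul a b) = cmul (s a) (s b)) ->
  (forall z a, s (cscale z a) = cscale z (s a)) ->
  s (cone M) = cone M ->
  exists2 S : X -> X, continuous S & forall a x, Phi (s a) x = Phi a (S x).
Proof.
move=> sD sM sZ s1.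
have /choice[S SE] x : exists y, forall a, Phi (s a) x = Phi a y.
  by apply: character_eval => [a b|a b|z a|]; rewrite ?sD ?sM ?sZ ?s1 PhiE.
exists S => // x V /clopen_nbhs[W [cW WSx] WV].
have [e eW] := iso_indicator cW.
(* The function s e takes only the values 0 and 1, so staying at distance less than 1 from the value
   1 forces S y into W. *)
have := (continuous_normcP _).1 (@CX_continuous _ _ _ _ iM (s e)) x 1 ltr01.
rewrite nbhs_filterE; apply: filterS => y; rewrite !SE !eW mem_set//.
case: ifPn => [|_]; first by rewrite inE => /WV.
by rewrite subr0 normc_one ltxx.
Qed.

(** The inverse of s respects the operations because s is injective, so it has a dual map as well;
    the two maps are mutually inverse because M separates points. *)
Lemma automorphism_dual (s : M -> M) : star_automorphism s ->
  exists S S' : X -> X, [/\ continuous S, continuous S', cancel S S',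
    cancel S' S & forall a x, Phi (s a) x = Phi a (S x)].
Proof.
case=> -[t sK tK] sD sZ sM s1 _.
have sI := can_inj sK.
have [S cS SE] := endomorphism_dual sD sM sZ s1.
have [||||S' cS' S'E] := @endomorphism_dual t.
- by move=> a b; apply: sI; rewrite sD !tK.
- by move=> a b; apply: sI; rewrite sM !tK.
- by move=> z a; apply: sI; rewrite sZ !tK.
- by apply: sI; rewrite s1 tK.
exists S, S'; split => // x; apply: iso_separates => a.
  by rewrite -S'E -SE tK.
by rewrite -SE -S'E sK.
Qed.

End Characters.

(** * Invariant signs *)

Section CstarEmbeddings.
Context {R : realType}.
Implicit Types M N : structure (L_cstar_sigma R).

Lemma vcons_eta1 (T : Type) (a : 'I_1 -> T) : a = vcons (a ord0) (@novar T).
Proof.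
by apply/funext => i; rewrite (ord1 i) vcons0.
Qed.

Lemma vcons_eta2 (T : Type) (a : 'I_2 -> T) :
  a = vcons (a ord0) (vcons (a ord_max) (@novar T)).
Proof.
apply/funext => i; case: (unliftP ord0 i) => [j|] ->; rewrite ?vconsS ?vcons0//.
rewrite (ord1 j) vcons0; congr a; exact: val_inj.
Qed.

Lemma cstar_embedding M N (h : M -> N) :
  (forall a b, mdist (h a) (h b) = mdist a b) ->
  (forall k a, dom k (h a) <-> dom k a) ->
  h (czero (reduct M)) = czero (reduct N) ->
  h (cone (reduct M)) = cone (reduct N) ->
  (forall a b : reduct M, h (cadd a b) = cadd (M := reduct N) (h a) (h b)) ->
  (forall a b : reduct M, h (cmul a b) = cmul (M := reduct N) (h a) (h b)) ->
  (forall a : reduct M, h (cstar a) = cstar (M := reduct N) (h a)) ->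
  (forall z (a : reduct M), h (cscale z a) = cscale (M := reduct N) z (h a)) ->
  (forall a, h (new_fun a) = new_fun (h a)) ->
  embedding h.
Proof.
move=> hd hk h0 h1 hD hM hS hZ hs; split => // -[[||||| z]|] a.
- by rewrite (eq_novar a) map_novar.
- by rewrite (eq_novar a) map_novar.
- rewrite (vcons_eta2 a) !map_vcons map_novar; exact: hD.
- rewrite (vcons_eta2 a) !map_vcons map_novar; exact: hM.
- rewrite (vcons_eta1 a) !map_vcons map_novar; exact: hS.
- rewrite (vcons_eta1 a) !map_vcons map_novar; exact: hZ.
- rewrite (vcons_eta1 a) !map_vcons map_novar; exact: hs.
Qed.

Context {M N : structure (L_cstar_sigma R)} {h : M -> N}.
Hypothesis eh : embedding h.

Lemma embedding_inj : injective h.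
Proof. by move=> a b ab; apply: mdist_positivity; rewrite -(emb_dist eh) ab mdistxx. Qed.

Lemma emb_cmul (a b : reduct M) : h (cmul a b) = cmul (M := reduct N) (h a) (h b).
Proof.
rewrite /cmul (_ : vcons (h a) _ = h \o vcons a (vcons b (@novar M))); last first.
  by rewrite !map_vcons map_novar.
exact: (emb_fint eh (f := Some (Cmul R))).
Qed.

Lemma emb_cone : h (cone (reduct M)) = cone (reduct N).
Proof. by rewrite /cone -(map_novar h); exact: (emb_fint eh (f := Some (Cone R))). Qed.

Lemma emb_new_fun (a : M) : h (new_fun a) = new_fun (h a).
Proof.
rewrite /new_fun (_ : vcons (h a) _ = h \o vcons a (@novar M)); last first.
  by rewrite map_vcons map_novar.
exact: (emb_fint eh (f := None)).
Qed.

Lemma emb_iter n (a : M) :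
  h (iter n (@new_fun _ _ M) a) = iter n (@new_fun _ _ N) (h a).
Proof. by elim: n => //= n <-; rewrite emb_new_fun. Qed.

End CstarEmbeddings.

(** * Tripotents, correlations and the separation formula *)

Section Separation.
Context {R : realType}.
Local Notation L := (L_cstar_sigma R).
Local Notation C := (Cplx R).

Definition tripotent (M : structure L) (f : reduct M) :=
  cmul (cmul f f) f = f.

Definition idempotent (M : structure L) (f : reduct M) := cmul f f = f.

(** As a function this is f(x) f(S^n x). For tripotent f it fails to be idempotent exactly when it
    takes the value -1, that is, when f has opposite signs at two points n steps apart. *)
Definition correlation n (M : structure L) (f : reduct M) : reduct M :=
  cmul f (iter n (@new_fun _ _ M) f).

Definition defect (M : structure L) (f c : reduct M) : R :=
  mdist (cmul c c) (cone (reduct M)) +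
  (mdist (@new_fun R (L_cstar R) M c) c + mdist (cmul c f) (cmul f f)).

Lemma embedding_tripotent (M N : structure L) (h : M -> N) f :
  embedding h -> tripotent (M := N) (h f) <-> tripotent f.
Proof.
move=> eh; rewrite /tripotent -!(emb_cmul eh); split => [/(embedding_inj eh)//|].
by move=> E; congr h.
Qed.

Lemma embedding_idempotent (M N : structure L) (h : M -> N) n f :
  embedding h ->
  idempotent (correlation n (h f : reduct N)) <-> idempotent (correlation n f).
Proof.
move=> eh; rewrite /idempotent /correlation -(emb_iter eh) -!(emb_cmul eh).
by split => [/(embedding_inj eh)//|E]; congr h.
Qed.

Definition tmul n (s t : term L n) : term L n :=
  @App R L n (Some (Cmul R)) (vcons s (vcons t (@novar _))).
Definition tone n : term L n := @App R L n (Some (Cone R)) (@novar _).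
Definition tsigma n (t : term L n) : term L n :=
  @App R L n None (vcons t (@novar _)).

Definition row_sum n (v : 'rV[R]_n) : R := \sum_j v ord0 j.

Lemma row_sum_continuous n : continuous (@row_sum n).
Proof.
apply: continuous_big => [|j _]; last exact: coord_continuous.
by move=> x; apply: (@cvgD _ R^o); [exact: cvg_fst|exact: cvg_snd].
Qed.

(** [FInf] binds x_0, so c is variable 0 and the free f is shifted to variable 1. Signs have norm at
    most 1, hence c ranges over D_1. *)
Definition separation_formula : formula L 1 :=
  let c := Var L ord0 in let f := Var L ord_max in
  FInf 1 (FConn (@row_sum_continuous 3)
    (vcons (FDist (tmul c c) (tone 2))
      (vcons (FDist (tsigma c) c)
        (vcons (FDist (tmul c f) (tmul f f)) (@novar _))))).

Lemma feval_separation (M : structure L) (v : 'I_1 -> M) :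
  feval separation_formula v = inf [set defect (v ord0) c | c in dom 1].
Proof.
rewrite /=; congr inf; apply: eq_imagel => c _.
rewrite /row_sum !big_ord_recl big_ord0 addr0 !mxE !vconsS !vcons0 /=.
have tv1 s : (fun i => teval (vcons c v) (vcons s (@novar (term L 2)) i)) =
    vcons (teval (vcons c v) s) (@novar M).
  by rewrite -[LHS]/(teval (vcons c v) \o _) map_vcons map_novar.
have tv2 s t :
    (fun i => teval (vcons c v) (vcons s (vcons t (@novar (term L 2))) i)) =
    vcons (teval (vcons c v) s) (vcons (teval (vcons c v) t) (@novar M)).
  by rewrite -[LHS]/(teval (vcons c v) \o _) !map_vcons map_novar.
rewrite tv1 !tv2 /= vcons_max vcons0 /defect /cmul /cone /new_fun /=.
by rewrite (eq_novar (fun i : 'I_0 => _)).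
Qed.

End Separation.

(** * The lower bound for the defect *)

Section Obstruction.
Context {R : realType} {M : structure (L_cstar_sigma R)} {X : topologicalType}.
Context {Phi : M -> X -> Cplx R} {S : X -> X}.
Hypotheses (cX : compact [set: X]) (iM : @iso_CX R (reduct M) X Phi).
Hypothesis PhiS : forall a x, Phi (new_fun a) x = Phi a (S x).
Local Notation C := (Cplx R).

Lemma iso_iter n a x : Phi (iter n (@new_fun _ _ M) a) x = Phi a (iter n S x).
Proof. by elim: n x => //= n IH x; rewrite PhiS IH -iterSr. Qed.

Lemma tripotent_values (f : reduct M) x : tripotent f ->
  [\/ Phi f x = 0, Phi f x = 1 | Phi f x = -1].
Proof.
move=> f3; have : Phi f x * ((Phi f x - 1) * (Phi f x + 1)) = 0.
  have := congr1 (Phi^~ x) f3; rewrite /= !(CX_mul iM) => E.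
  rewrite (_ : _ * _ = Phi f x * Phi f x * Phi f x - Phi f x); last by ring.
  by rewrite E subrr.
move=> /eqP; rewrite !mulf_eq0 subr_eq0 addr_eq0.
by move=> /or3P[] /eqP ->; [constructor 1|constructor 2|constructor 3].
Qed.

(* A function of modulus close to 1 which varies slowly along the orbit of a
   point cannot be close to 1 at one point of the orbit and to -1 at another. *)
Lemma defect_ge (f c : reduct M) n : tripotent f ->
  ~ idempotent (correlation n f) -> 2^-1 <= defect f c.
Proof.
move=> f3 nid.
have [x fx] : exists x, Phi f x * Phi f (iter n S x) = -1.
  apply: contrapT => nx; apply: nid; apply: (iso_inj iM) => x.
  rewrite !(CX_mul iM) iso_iter.
  have : Phi f x * Phi f (iter n S x) <> -1 by move=> fx; apply: nx; exists x.
  case: (tripotent_values x f3) => ->;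
    case: (tripotent_values (iter n S x) f3) => ->;
    by rewrite ?(mul0r, mulr0, mul1r, mulr1, mulrN, mulNr, opprK, oppr0).
set s := Phi f x in fx.
have ss : s * s = 1.
  rewrite /s; case: (tripotent_values x f3) fx => E; rewrite /s E; last 2 first.
  - by rewrite mulr1.
  - by rewrite mulrNN mulr1.
  by rewrite mul0r => /eqP; rewrite eq_sym oppr_eq0 oner_eq0.
have fn : Phi f (iter n S x) = - s by rewrite -[LHS]mul1r -ss -mulrA fx mulrN1.
have ns : normc s = 1.
  apply/eqP; rewrite -(@eqrXn2 _ 2) ?normc_ge0//.
  by rewrite expr1n expr2 -normc_mul ss normc_one.
rewrite leNgt; apply/negP => dlt.
have [d1 [d2 d3]] : mdist (cmul c c) (cone (reduct M)) < 2^-1 /\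
    (mdist (@new_fun _ _ M c) c < 2^-1 /\ mdist (cmul c f) (cmul f f) < 2^-1).
  have h1 : 0 <= mdist (cmul c c) (cone (reduct M)) := mdist_ge0 _ _.
  have h2 : 0 <= mdist (@new_fun R (L_cstar R) M c) c := mdist_ge0 _ _.
  have h3 : 0 <= mdist (cmul c f) (cmul f f) := mdist_ge0 _ _.
  by move: dlt; rewrite /defect; split; [lra|split; lra].
have D1 y : normc ((Phi c y - s) * (Phi c y + s)) < 2^-1.
  rewrite (_ : _ * _ = Phi (cmul c c) y - Phi (cone (reduct M)) y); last first.
    by rewrite (CX_mul iM) (CX_one iM) -ss; ring.
  by apply: le_lt_trans d1; exact: (iso_dist_ub cX iM).
have D2 y : normc (Phi c (S y) - Phi c y) < 2^-1.
  by rewrite -PhiS; apply: le_lt_trans d2; exact: (iso_dist_ub cX iM).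
(* Where f takes a value t with t^2 = 1, c f - f^2 = (c - t) t has modulus |c - t|. *)
have D3 y t : t * t = 1 -> normc t = 1 -> Phi f y = t -> normc (Phi c y - t) < 2^-1.
  move=> tt nt fy; apply: le_lt_trans d3.
  apply: le_trans (iso_dist_ub cX iM _ _ y); rewrite !(CX_mul iM) fy.
  by rewrite -mulrBl normc_mul nt mulr1.
have two : normc (s + s) = 2.
  by rewrite -[s]mul1r -mulrDl normc_mul ns mulr1 (normc_natr 2).
(* Distance less than 1/2 from s persists along the orbit: one step moves c by less than 1/2, so c
   is within 1 of s and more than 1 away from -s. Then |c - s| |c + s| = |c^2 - 1| < 1/2 brings |c -
   s| below 1/2 again. This is where the constant 1/2 comes from. *)
have near_s m : normc (Phi c (iter m S x) - s) < 2^-1.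
  elim: m => [|m IH]; first exact: D3.
  rewrite iterS; set y := iter m S x in IH *.
  have h1 : normc (Phi c (S y) - s) < 1.
    have := normc_triangle (Phi c y) (Phi c (S y)) s; have := D2 y.
    move: IH; set a := normc _; set b := normc _; set d := normc _; lra.
  have h2 : 1 < normc (Phi c (S y) + s).
    have := normc_triangle (Phi c (S y)) (- s) s; rewrite -opprD normc_opp two.
    rewrite -opprD normc_opp [s + _]addrC.
    move: h1; set a := normc _; set b := normc _; lra.
  have := D1 (S y); rewrite normc_mul.
  move: h2; set a := normc (_ - _); set b := normc _ => b1 ab.
  apply: le_lt_trans ab; rewrite ler_peMr//; [exact: normc_ge0|exact: ltW].
have h1 := near_s n.
have h2 : normc (Phi c (iter n S x) - - s) < 2^-1.
  by apply: D3 => //; rewrite ?mulrNN// normc_opp.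
have := normc_triangle (Phi c (iter n S x)) s (- s).
rewrite opprK two normc_distC; move: h1 h2; rewrite opprK.
by set a := normc _; set b := normc _; lra.
Qed.

End Obstruction.

(** * Extension by orbit signs *)

Lemma iter_cancel (T : Type) (g h : T -> T) :
  cancel g h -> forall m, cancel (iter m g) (iter m h).
Proof. by move=> gK; elim=> // m IH x; rewrite iterSr iterS gK IH. Qed.

Lemma zero_dimensional_hausdorff (T : topologicalType) :
  zero_dimensional T -> hausdorff_space T.
Proof.
move=> zT x y clxy; apply/eqP/negP => /negP xy.
have [V [[oV cV] Vx Vy]] := zT x y xy.
have [z [Vz nVz]] := clxy V (~` V) (open_nbhs_nbhs (conj oV Vx))
  (open_nbhs_nbhs (conj (closed_openC cV) Vy)).
exact: nVz.
Qed.

Lemma preimage_clopen (T U : topologicalType) (f : T -> U) (V : set U) :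
  continuous f -> clopen V -> clopen (f @^-1` V).
Proof.
move=> cf [oV cV]; split; first by move/continuousP: cf; exact.
by move/continuous_closedP: cf; exact.
Qed.

Lemma zero_dimensional_pair (T U : topologicalType) :
  zero_dimensional T -> zero_dimensional U -> zero_dimensional (T * U)%type.
Proof.
move=> zT zU [x y] [x' y']; have [<-|xx'] := eqVneq x x'; last first.
  move=> _; have [V [cV Vx Vx']] := zT x x' xx'.
  exists (fst @^-1` V); split => //; apply: preimage_clopen cV.
  by move=> z; exact: cvg_fst.
have [<-|yy'] := eqVneq y y'; first by rewrite eqxx.
move=> _; have [V [cV Vy Vy']] := zU y y' yy'.
exists (snd @^-1` V); split => //; apply: preimage_clopen cV.
by move=> z; exact: cvg_snd.
Qed.

Lemma perfect_pair (T U : topologicalType) :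
  perfect_set [set: U] -> perfect_set [set: T * U].
Proof.
move=> /perfectTP pU; apply/perfectTP => -[x y] oxy; apply: (pU y).
rewrite (_ : [set y] = (fun z => (x, z)) @^-1` [set (x, y)]); last first.
  by apply/seteqP; split => z /= => [->//|[]].
have /continuousP : continuous (fun z : U => (x, z)); last exact.
by move=> z; apply: cvg_pair; [exact: cvg_cst|exact: cvg_id].
Qed.

Lemma cantor_like_pair (T : topologicalType) :
  compact [set: T] -> zero_dimensional T -> cantor_like (T * cantor_space)%type.
Proof.
move=> cT zT; have [pC cC _ zC] := cantor_like_cantor_space.
have zTC := zero_dimensional_pair zT zC.
split => //; [exact: perfect_pair| |exact: zero_dimensional_hausdorff].
rewrite (_ : [set: _] = [set: T] `*` [set: cantor_space]); first exact: compact_setX.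
by apply/seteqP; split.
Qed.

Section Subspaces.
Context {T : topologicalType} (P : pred T).

Definition subspace_type : topologicalType :=
  initial_topology (val : {x : T | P x} -> T).

Definition subspace_val : subspace_type -> T := val.

Definition subspace_mk x (Px : P x) : subspace_type := exist (fun x => P x) x Px.

Lemma subspace_val_continuous : continuous subspace_val.
Proof. exact: initial_continuous. Qed.

Lemma continuous_subspace_val (U : topologicalType) (f : U -> subspace_type) :
  continuous (subspace_val \o f) -> continuous f.
Proof.
move=> cf; apply/continuousP => _ [A oA <-].
by move/continuousP: cf => /(_ A oA).
Qed.

Lemma subspace_compact : compact [set: T] -> closed [set x | P x] ->
  compact [set: subspace_type].
Proof.
move=> cT cP F FF _.
have cPT : compact [set x | P x] by exact: subclosed_compact cP cT _.
have FP : (subspace_val @ F) [set x | P x] by apply: (@filterE _ F) => x; exact: valP.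
have [p [/= Pp clp]] := cPT _ _ FP.
exists (exist _ p Pp); split => // A V FA; rewrite nbhsE => -[B [oB Bp] BV].
have [Q oQ QB] := oB.
have FvA : (subspace_val @ F) (subspace_val @` A).
  by apply: (@filterS _ F _ A) => [x Ax|//]; exists x.
have nQ : nbhs p Q by apply: open_nbhs_nbhs; split => //; rewrite -QB in Bp.
have [_ [[x Ax <-] Qx]] := clp _ _ FvA nQ.
by exists x; split => //; apply: BV; rewrite -QB.
Qed.

Lemma subspace_zero_dimensional : zero_dimensional T -> zero_dimensional subspace_type.
Proof.
move=> zT x y xy; have [V [cV Vx Vy]] := zT (subspace_val x) (subspace_val y) xy.
exists (subspace_val @^-1` V); split => //.
by apply: preimage_clopen cV; exact: subspace_val_continuous.
Qed.

End Subspaces.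

Section Extension.
Context {R : realType} {M : structure (L_cstar_sigma R)} {X : topologicalType}.
Context {Phi : M -> X -> Cplx R} {S S' : X -> X} {f : reduct M}.
Hypotheses (xX : cantor_like X) (iM : @iso_CX R (reduct M) X Phi).
Hypothesis PhiS : forall a x, Phi (new_fun a) x = Phi a (S x).
Hypotheses (cS : continuous S) (cS' : continuous S').
Hypotheses (SK : cancel S S') (S'K : cancel S' S).
Hypotheses (f3 : tripotent f) (fid : forall n, idempotent (correlation n f)).
Local Notation C := (Cplx R).

Definition sgnC (b : bool) : C := if b then 1 else -1.

(** Two natural exponents stand for the integer power S^(n - m); pairs (m, n) name the points of the
    full orbit with repetitions. *)
Definition orbit_point (m n : nat) (x : X) := iter m S' (iter n S x).

Definition sign_on_orbit (z : X * bool) : bool := `[< forall m n,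
  Phi f (orbit_point m n z.1) * Phi f (orbit_point m n z.1) =
  sgnC z.2 * Phi f (orbit_point m n z.1) >].

Lemma orbit_pointS m n x : orbit_point m n (S x) = orbit_point m n.+1 x.
Proof. by rewrite /orbit_point iterSr. Qed.

Lemma orbit_pointSK m n x : orbit_point m.+1 n (S x) = orbit_point m n x.
Proof. by rewrite orbit_pointS /orbit_point iterSr iterS SK. Qed.

Lemma sign_on_orbitS x e : sign_on_orbit (S x, e) = sign_on_orbit (x, e).
Proof.
apply/asboolP/asboolP => /= H m n; last by rewrite orbit_pointS.
by have := H m.+1 n; rewrite orbit_pointSK.
Qed.

Lemma sign_on_orbitS' x e : sign_on_orbit (S' x, e) = sign_on_orbit (x, e).
Proof. by rewrite -sign_on_orbitS S'K. Qed.

Lemma correlation_neqN1 x n : Phi f x * Phi f (iter n S x) <> -1.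
Proof.
have := congr1 (Phi^~ x) (fid n); rewrite /= !(CX_mul iM) (iso_iter PhiS).
move=> E E1; move: E; rewrite E1 mulrNN mulr1 => /eqP.
by rewrite -subr_eq0 opprK (_ : 1 + 1 = 2%:R)// pnatr_eq0.
Qed.

(** The hypothesis [fid] speaks of forward iterates only, so both points are rewritten as forward
    iterates of the common earlier point w = S'^(k + m) x, and the earlier of the two serves as
    starting point. *)
Lemma orbit_correlation x m n k l :
  Phi f (orbit_point m n x) = 1 -> Phi f (orbit_point k l x) <> -1.
Proof.
have comm i j y : iter i S' (iter j S y) = iter j S (iter i S' y).
  apply: (can_inj (iter_cancel SK i)); rewrite iter_cancel//.
  by rewrite -iterD addnC iterD iter_cancel.
have orbE i j t : orbit_point i j x = iter (t + j) S (iter (t + i) S' x).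
  by rewrite /orbit_point comm addnC iterD iterD iter_cancel.
rewrite (orbE m n k) (orbE k l m) addnC [(m + k)%N]addnC.
set w := iter _ S' x; set p := (n + k)%N; set q := (m + l)%N => fp fq.
case: (leqP p q) => [pq|/ltnW qp].
  apply: (correlation_neqN1 (x := iter p S w) (n := q - p)).
  by rewrite -iterD subnK// fp fq mul1r.
apply: (correlation_neqN1 (x := iter q S w) (n := p - q)).
by rewrite -iterD subnK// fp fq mulr1.
Qed.

(** The sign is positive if f takes the value 1 on the orbit and negative otherwise. This makes the
    extension project onto X, so that functions on X pull back isometrically. *)
Lemma sign_on_orbit_ex x : exists e, sign_on_orbit (x, e).
Proof.
have [[[m n] mn]|N1] :=
    pselect (exists p : nat * nat, Phi f (orbit_point p.1 p.2 x) = 1).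
  exists true; apply/asboolP => k l /=; rewrite mul1r.
  have := @orbit_correlation _ _ _ k l mn.
  case: (tripotent_values iM (orbit_point k l x) f3) => -> //.
    by rewrite mulr0.
  by rewrite mulr1.
exists false; apply/asboolP => k l /=; rewrite mulN1r.
have : Phi f (orbit_point k l x) <> 1 by move=> kl; apply: N1; exists (k, l).
case: (tripotent_values iM (orbit_point k l x) f3) => -> // _.
  by rewrite mulr0 oppr0.
by rewrite mulrNN mulr1 opprK.
Qed.

Lemma orbit_point_continuous m n : continuous (orbit_point m n).
Proof.
have cit (g : X -> X) k : continuous g -> continuous (iter k g).
  move=> cg; elim: k => [|k IH] x; first exact: cvg_id.
  by apply: (@continuous_comp _ _ _ (iter k g) g); [exact: IH|exact: cg].
move=> x; apply: (@continuous_comp _ _ _ (iter n S) (iter m S')); exact: cit.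
Qed.

Lemma sgnC_continuous : continuous sgnC.
Proof.
move=> b V Vb.
apply: (@filterS _ (nbhs b) (nbhs_filter b) [set b] (sgnC @^-1` V)).
  by move=> _ ->; exact: (@nbhs_singleton _ (sgnC b) V Vb).
exact: discrete_set1.
Qed.

Lemma sign_on_orbit_closed : closed [set z | sign_on_orbit z].
Proof.
pose g m n (z : X * bool) : C := Phi f (orbit_point m n z.1) - sgnC z.2.
pose g' m n (z : X * bool) : C := g m n z * Phi f (orbit_point m n z.1).
have -> : [set z | sign_on_orbit z] =
    \bigcap_(p in [set: nat * nat]) (g' p.1 p.2 @^-1` [set 0]).
  apply/seteqP; split => z /=.
    by move=> /asboolP H p _ /=; rewrite /g' /g mulrBl H subrr.
  move=> H; apply/asboolP => m n; apply/eqP; rewrite -subr_eq0 -mulrBl.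
  by apply/eqP; exact: (H (m, n)).
apply: closed_bigI => p _; have /continuous_closedP : continuous (g' p.1 p.2).
  have cp : continuous (fun z : X * bool => Phi f (orbit_point p.1 p.2 z.1)).
    move=> z; apply: (@continuous_comp _ _ _ fst (Phi f \o orbit_point p.1 p.2)).
      exact: cvg_fst.
    apply: continuous_comp; first exact: orbit_point_continuous.
    exact: (CX_continuous iM).
  apply: (continuous_mulf _ cp).
  move=> z; apply: (@cvgB _ C^o); first exact: cp.
  apply: (@continuous_comp _ _ _ snd sgnC); [exact: cvg_snd|exact: sgnC_continuous].
apply; apply: accessible_closed_set1; apply: hausdorff_accessible.
exact: norm_hausdorff.
Qed.

Definition signed_space : topologicalType := subspace_type sign_on_orbit.

Lemma signed_space_compact : compact [set: signed_space].
Proof.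
apply: subspace_compact sign_on_orbit_closed.
rewrite (_ : [set: _] = [set: X] `*` [set: bool]); last by apply/seteqP; split.
by apply: compact_setX; [case: xX|exact: bool_compact].
Qed.

Lemma signed_space_zero_dimensional : zero_dimensional signed_space.
Proof.
apply: subspace_zero_dimensional; apply: zero_dimensional_pair; first by case: xX.
exact: discrete_zero_dimension.
Qed.

Lemma signed_map_subproof (g : X -> X) :
  (forall x e, sign_on_orbit (g x, e) = sign_on_orbit (x, e)) ->
  forall k : signed_space, sign_on_orbit (g (subspace_val k).1, (subspace_val k).2).
Proof. by move=> gE k; rewrite gE -surjective_pairing; exact: valP. Qed.

(** The sign coordinate is carried along unchanged, so it is an invariant function by
    construction. *)
Definition signed_map (g : X -> X)
    (gE : forall x e, sign_on_orbit (g x, e) = sign_on_orbit (x, e))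
    (y : signed_space * cantor_space) : signed_space * cantor_space :=
  (subspace_mk (signed_map_subproof gE y.1), y.2).

Definition base_point (y : signed_space * cantor_space) : X := (subspace_val y.1).1.

Definition base_sign (y : signed_space * cantor_space) : bool := (subspace_val y.1).2.

Lemma base_continuous :
  continuous (fun y : signed_space * cantor_space => subspace_val y.1).
Proof.
move=> y; apply: (@continuous_comp _ _ _ fst (@subspace_val _ sign_on_orbit)).
  exact: cvg_fst.
exact: subspace_val_continuous.
Qed.

Lemma base_point_continuous : continuous base_point.
Proof.
move=> y; apply: (@continuous_comp _ _ _ (fun y => subspace_val y.1) fst).
  exact: base_continuous.
exact: cvg_fst.
Qed.

Lemma base_sign_continuous : continuous base_sign.
Proof.
move=> y; apply: (@continuous_comp _ _ _ (fun y => subspace_val y.1) snd).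
  exact: base_continuous.
exact: cvg_snd.
Qed.

Lemma signed_map_continuous g gE : continuous g -> continuous (@signed_map g gE).
Proof.
move=> cg; pose h (y : signed_space * cantor_space) :=
  subspace_mk (signed_map_subproof gE y.1).
have ch : continuous h; last first.
  move=> y; apply: (@cvg_pair _ _ _ (nbhs y) (nbhs (h y)) (nbhs y.2) _ _ _ h snd).
    exact: ch.
  exact: cvg_snd.
apply: continuous_subspace_val => y.
apply: (@cvg_pair _ _ _ (nbhs y) (nbhs (g (base_point y))) (nbhs (base_sign y))
  _ _ _ (g \o base_point) base_sign); last exact: base_sign_continuous.
apply: (@continuous_comp _ _ _ base_point g); [exact: base_point_continuous|exact: cg].
Qed.

Lemma signed_mapK g g' gE gE' :
  cancel g g' -> cancel (@signed_map g gE) (@signed_map g' gE').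
Proof.
move=> gK [[[x e] p] t]; congr pair; apply: val_inj => /=.
by rewrite /subspace_val /= gK.
Qed.

(* The extension lives on the pairs of a point and a sign carried by [f] along
   its orbit, times the Cantor space to remove isolated points. *)
Lemma cantor_extension :
  exists (Y : topologicalType) (T T' : Y -> Y) (p : Y -> X) (e : Y -> C),
  [/\ cantor_like Y, [/\ continuous T, continuous T', cancel T T' & cancel T' T],
    [/\ continuous p, (forall x, exists y, p y = x) & forall y, p (T y) = S (p y)] &
    [/\ continuous e, (forall y, e y * e y = 1), (forall y, e (T y) = e y) &
      forall y, e y * Phi f (p y) = Phi f (p y) * Phi f (p y)]].
Proof.
exists (signed_space * cantor_space)%type, (signed_map sign_on_orbitS),
  (signed_map sign_on_orbitS'), base_point, (sgnC \o base_sign); split.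
- apply: cantor_like_pair; first exact: signed_space_compact.
  exact: signed_space_zero_dimensional.
- by split; [exact: signed_map_continuous|exact: signed_map_continuous|
    exact: signed_mapK|exact: signed_mapK].
- split => //; first exact: base_point_continuous.
  move=> x; have [e xe] := sign_on_orbit_ex x.
  by exists (subspace_mk xe, point).
- split => //.
  + move=> y; apply: continuous_comp; first exact: base_sign_continuous.
    exact: sgnC_continuous.
  + by move=> y /=; case: (base_sign y); rewrite ?mulr1// mulrNN mulr1.
  + by case=> [[[x e] xe] t]; have /asboolP/(_ 0%N 0%N) /= := xe.
Qed.

End Extension.

(** * Pullback along a factor map *)

Section ExtensionAlgebra.
Context {R : realType} {M : structure (L_cstar_sigma R)} {X Y : topologicalType}.
Context {Phi : M -> X -> Cplx R} {S : X -> X} {T : Y -> Y} {p : Y -> X}.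
Hypotheses (cX : compact [set: X]) (iM : @iso_CX R (reduct M) X Phi).
Hypothesis PhiS : forall a x, Phi (new_fun a) x = Phi a (S x).
Hypotheses (cY : compact [set: Y]) (cT : continuous T).
Hypotheses (cp : continuous p) (p_surj : forall x, exists y, p y = x).
Hypothesis pT : forall y, p (T y) = S (p y).

Lemma pullback_continuous (a : M) : continuous (Phi a \o p).
Proof.
by move=> y; apply: continuous_comp; [exact: cp|exact: (CX_continuous iM)].
Qed.

Definition pullback (a : M) : system_algebra cY cT := CFun (@pullback_continuous a).

(** Surjectivity of [p] makes the pullback isometric and lets it reflect the balls; p T = S p makes
    it commute with the automorphisms. *)
Lemma pullback_embedding : embedding pullback.
Proof.
have iN := system_iso (R := R) cY cT.
have hE a y : system_eval (pullback a) y = Phi a (p y) by [].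
have E := (CX_zero iM, CX_one iM, CX_add iM, CX_mul iM, CX_star iM, CX_scale iM).
have F := (CX_zero iN, CX_one iN, CX_add iN, CX_mul iN, CX_star iN, CX_scale iN).
apply: cstar_embedding.
- move=> a b; apply/eqP; rewrite eq_le; apply/andP; split.
    apply: (iso_dist_le iN) => [|y]; first exact: mdist_ge0.
    by rewrite !hE; exact: (iso_dist_ub cX iM).
  apply: (iso_dist_le iM) => [|x]; first exact: mdist_ge0.
  have [y <-] := p_surj x; rewrite -!hE; exact: (iso_dist_ub cY iN).
- move=> k a; split => [ka|/(CX_dom iM) ka].
    apply/(CX_dom iM) => x; have [y <-] := p_surj x.
    exact: ((CX_dom iN k _).1 ka y).
  by apply/(CX_dom iN) => y; rewrite hE.
- by apply: (iso_inj iN) => y; rewrite F hE E.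
- by apply: (iso_inj iN) => y; rewrite F hE E.
- by move=> a b; apply: (iso_inj iN) => y; rewrite F !hE E.
- by move=> a b; apply: (iso_inj iN) => y; rewrite F !hE E.
- by move=> a; apply: (iso_inj iN) => y; rewrite F !hE E.
- by move=> z a; apply: (iso_inj iN) => y; rewrite F !hE E.
- by move=> a; apply: (iso_inj iN) => y; rewrite system_evalS !hE PhiS pT.
Qed.

End ExtensionAlgebra.

(** * Products of finite rotations *)

Lemma discrete_finite_compact (T : finType) : compact [set: discrete_topology T].
Proof.
move=> F FF _; apply: contrapT => nF.
have /filter_ex[x /(_ x)] : \forall x \near F, forall y : T, x <> y.
  apply: filter_forall => y; apply: contrapT => nFy; apply: nF.
  exists y; split => // A V FA Vy; apply: contrapT => AV; apply: nFy.
  apply: (@filterS _ F _ A) => // x Ax xy; apply: AV; exists y.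
  by split; [rewrite -xy|exact: (@nbhs_singleton (discrete_topology T) y V Vy)].
by [].
Qed.

Lemma continuous_into_prod (I : Type) (K : I -> topologicalType) (T : topologicalType)
    (g : T -> prod_topology K) :
  (forall k, continuous (fun x => g x k)) -> continuous g.
Proof.
move=> cg x; apply/cvg_sup => k A; rewrite nbhsE => -[B [oB Bx] BA].
have [Q oQ QB] := oB.
have nQ : nbhs (g x k) Q.
  by apply: open_nbhs_nbhs; split => //; rewrite -QB in Bx.
apply: (@filterS _ (nbhs x) (nbhs_filter x) _ _ _ (cg k x Q nQ)) => y Qy.
by apply: BA; rewrite -QB.
Qed.

Section Rotations.
Context {R : realType}.
Local Notation C := (Cplx R).

(** In the cyclic group of order 2(k + 1) the element k + 1 is k + 1 steps away from 0 in both
    directions. *)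
Definition cyclic_space k : topologicalType := discrete_topology 'Z_(k.+1.*2).

(** The product puts the markers of all k into one model, and having infinitely many nontrivial
    factors makes it perfect. *)
Definition rotation_space : topologicalType := prod_topology cyclic_space.

(** A general step d in each coordinate lets the inverse be a rotation too, with steps -1. *)
Definition rotation (d : forall k, 'Z_(k.+1.*2)) (x : rotation_space) : rotation_space :=
  fun k => (x k : 'Z_(k.+1.*2)) + d k.

Lemma cantor_like_rotation : cantor_like rotation_space.
Proof.
have zK k : zero_dimensional (cyclic_space k) by exact: discrete_zero_dimension.
split.
- apply: perfect_diagonal => k; exists ((0 : 'Z_(k.+1.*2)), (1 : 'Z_(k.+1.*2))) => /=.
  have z1 : (0 : 'Z_(k.+1.*2)) != 1 by rewrite eq_sym oner_neq0.
  exact: z1.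
- have := @tychonoff _ cyclic_space (fun=> setT).
  rewrite (_ : [set f | _] = setT); last by apply/seteqP; split.
  apply => k; exact: discrete_finite_compact.
- exact: zero_dimensional_hausdorff (zero_dimension_prod zK).
- exact: zero_dimension_prod.
Qed.

Lemma continuous_coordinate k (T : topologicalType) (g : 'Z_(k.+1.*2) -> T) :
  continuous (fun x : rotation_space => g (x k)).
Proof.
move=> x V Vg; apply: (@filterS _ (nbhs x) (nbhs_filter x) _ _ _
  (@proj_continuous _ cyclic_space k x [set x k] (discrete_set1 _))) => y yk.
by rewrite /preimage /= (_ : y k = x k)//; exact: nbhs_singleton Vg.
Qed.

Lemma rotation_continuous d : continuous (rotation d).
Proof.
apply: continuous_into_prod => k.
exact: (@continuous_coordinate k (cyclic_space k) (fun z => z + d k)).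
Qed.

Lemma rotationK d d' : (forall k, d k + d' k = 0) -> cancel (rotation d) (rotation d').
Proof.
move=> dd x; apply/functional_extensionality_dep => k.
by rewrite /rotation -addrA dd addr0.
Qed.

Lemma iter_rotation1 n (x : rotation_space) k :
  iter n (rotation (fun=> 1)) x k = (x k : 'Z_(k.+1.*2)) + n%:R.
Proof.
elim: n => [|n IH]; first by rewrite addr0.
by rewrite iterS {1}/rotation IH -addrA natr1.
Qed.

(* Along an orbit of the rotation by 1, the values 1 and -1 of the k-th marker
   are k + 1 steps apart. *)
Definition marker k (z : 'Z_(k.+1.*2)) : C :=
  if z == 0 then 1 else if z == k.+1%:R then -1 else 0.

Lemma marker_tripotent k z : @marker k z * @marker k z * @marker k z = @marker k z.
Proof.
by rewrite /marker; case: ifP => _; [|case: ifP => _];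
  rewrite ?mulr0 ?mulrNN ?(mulr1, mul1r).
Qed.

Lemma marker_norm k z : normc (@marker k z) <= 1.
Proof.
by rewrite /marker; case: ifP => _; [|case: ifP => _];
  rewrite ?normc_opp ?normc_one ?normc_zero.
Qed.

Lemma cyclic_natr_neq k m n : (m < n)%N -> (n < m + k.+1.*2)%N ->
  (m%:R : 'Z_(k.+1.*2)) != n%:R.
Proof.
move=> mn nm; apply/eqP => /(congr1 val) /=.
rewrite !val_Zp_nat// => /eqP; rewrite eq_sym eqn_mod_dvd 1?ltnW//.
by move=> /dvdnP[q]; case: q => [|q]; lia.
Qed.

Lemma marker_half k : @marker k 0 * @marker k (0 + k.+1%:R) = -1.
Proof.
rewrite add0r /marker eqxx mul1r; case: ifPn => [/eqP E|_]; last by rewrite eqxx.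
have := @cyclic_natr_neq k 0 k.+1 isT; rewrite E eqxx => /(_ _) H.
by have := H ltac:(lia).
Qed.

(** The product could be -1 only between 0 and k + 1. From 0 this would take n = k + 1 modulo 2(k +
    1), from k + 1 it would take k + 1 + n = 0; n <= k excludes both. *)
Lemma marker_idempotent k n z : (n <= k)%N ->
  let g := @marker k z * @marker k (z + n%:R) in g * g = g.
Proof.
move=> nk /=; suff : @marker k z * @marker k (z + n%:R) <> -1 :> C.
  rewrite /marker; do 2 ?[case: ifP => _]; do 2 ?[case: ifP => _];
  by rewrite ?(mul0r, mulr0, mul1r, mulr1, mulrN, mulNr, opprK, oppr0).
have N1 : (1 : C) <> -1.
  by move/eqP; rewrite -subr_eq0 opprK (_ : 1 + 1 = 2%:R)// pnatr_eq0.
have N0 : (0 : C) <> -1.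
  by move/eqP; rewrite eq_sym oppr_eq0 oner_eq0.
rewrite /marker; have [->|z0] := eqVneq z 0.
  rewrite add0r mul1r; case: ifPn => // n0; case: ifPn => // /eqP nk1.
  by have := @cyclic_natr_neq k n k.+1 ltac:(lia) ltac:(lia); rewrite nk1 eqxx.
have [->|zk] := eqVneq z k.+1%:R; last by rewrite mul0r.
case: ifPn => [/eqP|_]; last first.
  by case: ifPn => _; rewrite ?mulrNN ?mulr1 ?mulr0.
rewrite -natrD => E.
have := @cyclic_natr_neq k 0 (k.+1 + n) ltac:(lia) ltac:(lia).
by rewrite E eqxx.
Qed.

End Rotations.

(** * The theorem *)

Lemma embedding_defect (R : realType) (M N : structure (L_cstar_sigma R)) (h : M -> N)
    (f c : reduct M) :
  embedding h -> h (cone (reduct M)) = cone (reduct N) ->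
  defect (M := N) (h f) (h c) = defect f c.
Proof.
by move=> eh h1; rewrite /defect -h1 -(emb_new_fun eh) -!(emb_cmul eh) !(emb_dist eh).
Qed.

(** * Equations and theories in the ultrapower *)

Section UltrapowerAlgebra.
Context {R : realType} {M : structure (L_cstar_sigma R)} {U : set_system nat}.
Hypotheses (UU : UltraFilter U) (Uoo : \oo `<=` U) (domM : dom_nested M).
Local Notation P := (ultrapower UU Uoo domM).

(** Through this lemma an equation that holds for almost all indices passes to the ultrapower,
    although it may fail at finitely many of them. *)
Lemma uclass_near_eq (a b : P) u v : uclass a u -> uclass b v ->
  (\forall i \near U, u i = v i) -> a = b.
Proof.
move=> au bv uv; apply: (updist_eq0 UU); rewrite (updist_uclass UU au bv).
apply: (udist_unique UU); apply: cvg_near_cst.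
by apply: filterS uv => i ->; rewrite mdistxx.
Qed.

Lemma uclass_cmul (a b : reduct P) u v : uclass (a : P) u -> uclass (b : P) v ->
  uclass (cmul a b : P) (fun i => cmul (M := reduct M) (u i) (v i)).
Proof.
move=> au bv.
pose Q (c : P) (w : nat -> M) : Prop := uclass c w.
have Q0 (i : 'I_0) : Q (novar P i) (novar (nat -> M) i) by case: i.
have ab := @vcons_ind P (nat -> M) Q 1 a _ u _ au (@vcons_ind P _ Q 0 b _ v _ bv Q0).
have := uclass_ufint domM (f := Some (Cmul R)) ab.
by under eq_fun do rewrite -[fun j => _]/((fun w => w _) \o _) !map_vcons map_novar.
Qed.

Lemma uclass_new_fun (a : P) u : uclass a u ->
  uclass (new_fun a : P) (fun i => new_fun (u i)).
Proof.
move=> au.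
pose Q (c : P) (w : nat -> M) : Prop := uclass c w.
have Q0 (i : 'I_0) : Q (novar P i) (novar (nat -> M) i) by case: i.
have ab := @vcons_ind P (nat -> M) Q 0 a _ u _ au Q0.
have := uclass_ufint domM (f := None) ab.
by under eq_fun do rewrite -[fun j => _]/((fun w => w _) \o _) !map_vcons map_novar.
Qed.

Lemma uclass_correlation n (a : reduct P) u : uclass (a : P) u ->
  uclass (correlation n a : P) (fun i => correlation n (u i : reduct M)).
Proof.
move=> au; apply: uclass_cmul => //.
by elim: n => //= n IH; exact: uclass_new_fun.
Qed.

Lemma ultrapower_models T : models T M -> models T P.
Proof.
move=> MT phi Tphi.
have vP (j : 'I_0) : uclass (novar P j : P) (novar (nat -> M) j) by case: j.
have phiP := los (phi := phi) vP.
have phi0 : (fun i => feval phi (fun j => novar (nat -> M) j i)) = cst 0.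
  by apply/funext => i; rewrite (eq_novar (fun j => _)) MT.
apply/esym; apply: (@cvg_unique R^o _ (cst 0 @ U)).
- exact: norm_hausdorff.
- exact: cvg_cst.
- by rewrite -phi0.
Qed.

End UltrapowerAlgebra.

(** * The contradiction with a model companion *)

Section NoModelCompanion.
Context {R : realType} {Tcantor : theory (L_cstar R)}
  {TcstarA : theory (L_cstar_sigma R)}.
Hypotheses (hcantor : axiomatizes_cantor Tcantor)
  (hcstarA : axiomatizes_cstar_A TcstarA).
Local Notation L := (L_cstar_sigma R).
Local Notation T := (T_cantor_A Tcantor TcstarA).
Local Notation C := (Cplx R).

Let modelsE := models_cantor_A hcantor hcstarA.

Lemma models_defect_ge (M : structure L) (f c : reduct M) n :
  models T M -> tripotent f -> ~ idempotent (correlation n f) -> 2^-1 <= defect f c.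
Proof.
move=> /modelsE[[X xX [Phi iM]] aM].
have [S [S' [_ _ _ _ PhiS]]] := automorphism_dual xX iM aM.
by apply: (defect_ge _ iM PhiS); case: xX.
Qed.

Lemma models_extension (M : structure L) (f : reduct M) :
  models T M -> tripotent f -> (forall n, idempotent (correlation n f)) ->
  exists (N : structure L) (h : M -> N) (c : N),
    [/\ models T N, embedding h, dom 1 c & defect (M := N) (h f) c = 0].
Proof.
move=> /modelsE[[X xX [Phi iM]] aM] f3 fid.
have cX : compact [set: X] by case: xX.
have [S [S' [cS cS' SK S'K PhiS]]] := automorphism_dual xX iM aM.
have [Y [t [t' [p [e [xY [ct ct' tK t'K] [cp p_surj pt] [ce ee et ef]]]]]]] :=
  cantor_extension xX iM PhiS cS cS' SK S'K f3 fid.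
have cY : compact [set: Y] by case: xY.
pose N := system_algebra (R := R) cY ct.
have iN := system_iso (R := R) cY ct.
pose h : M -> N := pullback iM cY ct cp.
pose c : N := CFun ce.
exists N, h, c; split.
- apply/modelsE; split; last exact: system_automorphism t'K.
  by exists Y => //; exists (@system_eval _ _ _ cY ct).
- exact: (pullback_embedding cX iM PhiS).
- apply/(CX_dom iN) => y; rewrite le_eqVlt; apply/orP; left; apply/eqP.
  apply/eqP; rewrite -(@eqrXn2 _ 2) ?normc_ge0// expr1n expr2 -normc_mul.
  by rewrite -[system_eval c y]/(e y) ee normc_one.
have hf y : system_eval (h f) y = Phi f (p y) by [].
have cE y : system_eval c y = e y by [].
have c1 : cmul (M := reduct N) c c = cone (reduct N).
  by apply: (iso_inj iN) => y; rewrite (CX_mul iN) (CX_one iN) cE ee.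
have c2 : new_fun c = c.
  by apply: (iso_inj iN) => y; rewrite system_evalS !cE et.
have c3 : cmul (M := reduct N) c (h f) = cmul (M := reduct N) (h f) (h f).
  by apply: (iso_inj iN) => y; rewrite !(CX_mul iN) cE hf ef.
by rewrite /defect c1 c2 c3 !mdistxx !addr0.
Qed.

Lemma base_model : exists (M : structure L) (f : nat -> M),
  [/\ models T M, (forall k, dom 1 (f k)), (forall k, tripotent (f k : reduct M)),
    (forall k n, (n <= k)%N -> idempotent (correlation n (f k : reduct M))) &
    forall k, ~ idempotent (correlation k.+1 (f k : reduct M))].
Proof.
pose X := rotation_space; have xX : cantor_like X := cantor_like_rotation.
have cX : compact [set: X] by case: xX.
pose S := rotation (fun=> 1); pose S' := rotation (fun=> -1).
have cS : continuous S := rotation_continuous (d := fun=> 1).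
have cS' : continuous S' := rotation_continuous (d := fun=> -1).
pose M := system_algebra (R := R) cX cS.
pose ev : M -> X -> C := @system_eval R X S cX cS.
have iM : @iso_CX R (reduct M) X ev := system_iso (R := R) cX cS.
have MS (a : M) x : ev (new_fun a) x = ev a (S x) := system_evalS a x.
have cf k : continuous (fun x : X => @marker R k (x k)) :=
  @continuous_coordinate k C (@marker R k).
pose f k : M := CFun (cf k).
have fE k x : ev (f k) x = @marker R k (x k) by [].
have corrE n k x : ev (correlation n (f k : reduct M)) x =
    @marker R k (x k) * @marker R k ((x k : 'Z_(k.+1.*2)) + n%:R).
  by rewrite /correlation (CX_mul iM) (iso_iter MS) !fE iter_rotation1.
exists M, f; split.
- apply/modelsE; split; first by exists X => //; exists ev.
  apply: (@system_automorphism R X S S') => //; apply: rotationK => k.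
    by rewrite subrr.
  by rewrite addNr.
- by move=> k; apply/(CX_dom iM) => x; rewrite fE marker_norm.
- by move=> k; apply: (iso_inj iM) => x; rewrite !(CX_mul iM) !fE marker_tripotent.
- move=> k n nk; apply: (iso_inj iM) => x.
  by rewrite (CX_mul iM) corrE marker_idempotent.
- move=> k /(congr1 (fun a => ev a (fun=> 0))).
  rewrite (CX_mul iM) corrE marker_half mulrNN mulr1 => /eqP.
  by rewrite -subr_eq0 opprK (_ : 1 + 1 = 2%:R)// pnatr_eq0.
Qed.

Lemma models_dom_nested (M : structure L) : models T M -> dom_nested M.
Proof.
move=> /modelsE[[X _ [Phi iM]] _] k l kl a /(CX_dom iM) ka.
by apply/(CX_dom iM) => x; rewrite (le_trans (ka x))// ler_nat.
Qed.

Lemma no_model_companion (T' : theory L) : ~ model_companion T T'.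
Proof.
move=> [mcT' TT' T'T].
have [M [f [MT f1 f3 fid fnid]]] := base_model.
have [N [i [NT' ei]]] := TT' M MT.
have [N' [j [N'T ej]]] := T'T N NT'.
(* Nothing is known about the domains of a model of T'; nestedness descends from a model of T
   because embeddings preserve and reflect domains. *)
have domN : dom_nested N.
  move=> k l kl a ka; apply/(emb_dom ej); apply: (models_dom_nested N'T kl).
  exact/(emb_dom ej).
(* U refines the cofinite filter, so for fixed n the condition n <= k holds for almost all k. *)
have [U [UU Uoo]] := @ultraFilterLemma nat \oo _.
pose P := ultrapower UU Uoo domN.
have bg : ubounded (i \o f) by exists 1%N => k; exact/(emb_dom ei).
pose g : P := ucls U bg.
have gg : uclass g (i \o f) := uclass_ucls UU bg.
have PT' : models T' P by exact: ultrapower_models.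
have g3 : tripotent (g : reduct P).
  apply: uclass_near_eq (uclass_cmul (uclass_cmul gg gg) gg) gg _.
  by apply: (@filterE _ U) => k; apply/(embedding_tripotent _ ei).
have gid n : idempotent (correlation n (g : reduct P)).
  have gn := uclass_correlation n gg.
  apply: uclass_near_eq (uclass_cmul gn gn) gn _.
  apply: filterS (near_ultra_ge Uoo n) => k nk.
  by apply/(embedding_idempotent n _ ei); exact: fid.
pose phi := @separation_formula R.
have phig : 2^-1 <= feval phi (fun=> g).
  have := los (phi := phi) (v := fun=> i \o f) (fun=> gg).
  move/cvgr_to_ge; apply; apply: (@filterE _ U) => k.
  rewrite feval_separation; apply: lb_le_inf.
    by have [c c1] := dom_neq0 N 1; exists (defect (M := N) (i (f k)) c), c.
  move=> _ [c _ <-].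
  (* [N] is only a model of T', so the defect is estimated in the model [N'] of T, where the
     correlation at k + 1 still fails to be idempotent. *)
  rewrite -(embedding_defect _ _ ej (emb_cone ej)).
  apply: (@models_defect_ge _ _ _ k.+1 N'T).
    by apply/(embedding_tripotent _ ej)/(embedding_tripotent _ ei).
  by move/(embedding_idempotent _ _ ej)/(embedding_idempotent _ _ ei); exact: fnid.
have [Q [q [QT eq_]]] := T'T P PT'.
have q3 : tripotent (q g : reduct Q) by apply/(embedding_tripotent _ eq_).
have qid n : idempotent (correlation n (q g : reduct Q)).
  by apply/(embedding_idempotent n _ eq_).
have [Q1 [q1 [c [Q1T eq1 c1 c0]]]] := models_extension QT q3 qid.
have [Q2 [q2 [Q2T' eq2]]] := TT' Q1 Q1T.
have eP := embedding_comp eq_ (embedding_comp eq1 eq2).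
have phi0 : feval phi (fun=> q2 (q1 (q g))) <= 0.
  rewrite feval_separation; apply: ge_inf.
    by exists 0 => _ [d _ <-]; rewrite /defect !addr_ge0 ?mdist_ge0.
  exists (q2 c); first exact/(emb_dom eq2).
  by rewrite (embedding_defect _ _ eq2 (emb_cone eq2)).
have := mcT' P Q2 _ PT' Q2T' eP 1 phi (fun=> g) => E.
by have := le_trans phig (eq_ind _ (fun r => r <= 0) phi0 _ E); rewrite invr_le0 lern0.
Qed.

End NoModelCompanion.

Theorem theorem2p1 (R : realType) (Tcantor : theory (L_cstar R))
    (TcstarA : theory (L_cstar_sigma R))
    (hcantor : axiomatizes_cantor Tcantor)
    (hcstarA : axiomatizes_cstar_A TcstarA) :
  [/\ ~ (exists T' : theory (L_cstar_sigma R),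
           model_companion (T_cantor_A Tcantor TcstarA) T'),
      ~ model_complete (T_cantor_A Tcantor TcstarA) &
      ~ quantifier_elimination (T_cantor_A Tcantor TcstarA)].
Proof.
have nmc := no_model_companion hcantor hcstarA.
split.
- by case=> T' /nmc.
- by move=> /model_companion_refl/nmc.
- by move=> /quantifier_elimination_model_complete/model_companion_refl/nmc.
Qed.
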